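(* Let $d\ge 1$ and $n\geq 3$ be integers. Let $x_0=1$, let $x_1,\dots,x_{d-1}\in\mathbb{C}$ and $z\in K=\mathbb{C}(u)$, and let ${\rm tr}$ be the Markov trace on $\bigcup_{m\ge1}{\rm Y}_{d,m}(u)$ with parameters $z,x_1,\dots,x_{d-1}$. Then ${\rm tr}$ passes to the quotient ${\rm YTL}_{d,n}(u)$ if and only if the $x_i$'s are a solution of the ${\rm E}$-system and one of the following two cases holds: (i) for some $0\le m_1\le d-1$ we have $x_\ell=\exp(\ell m_1)$ for all $0\le \ell\le d-1$ (so the $x_\ell$'s are $d$-th roots of unity), and $z=-\frac{1}{u+1}$ or $z=-1$; (ii) for some $0\le m_1,m_2\le d-1$ with $m_1\neq m_2$ we have $x_\ell=\frac12\left(\exp(\ell m_1)+\exp(\ell m_2)\right)$ for all $0\le \ell\le d-1$, and $z=-\frac12$.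
   Context: Let $u$ be an indeterminate and $K=\mathbb{C}(u)$; algebras are associative unital $K$-algebras. Here $\exp(k):=\cos\frac{2\pi k}{d}+i\sin\frac{2\pi k}{d}$ for integers $k$. The Yokonuma--Hecke algebra ${\rm Y}_{d,n}(u)$ is the $K$-algebra generated by $g_1,\dots,g_{n-1},t_1,\dots,t_n$ subject to: $g_ig_j=g_jg_i$ for $|i-j|>1$; $g_{i+1}g_ig_{i+1}=g_ig_{i+1}g_i$; $g_i^2=1+(u-1)e_i+(u-1)e_ig_i$; $t_it_j=t_jt_i$ for all $i,j$; $t_i^d=1$; $g_it_i=t_{i+1}g_i$; $g_it_{i+1}=t_ig_i$; $g_it_j=t_jg_i$ for $j\ne i,i+1$; where $e_i:=\frac1d\sum_{s=0}^{d-1}t_i^st_{i+1}^{-s}$. One regards ${\rm Y}_{d,n}(u)\subset{\rm Y}_{d,n+1}(u)$ in the natural way. For $|i-j|=1$ put $g_{i,j}:=1+g_i+g_j+g_ig_j+g_jg_i+g_ig_jg_i$. For $n\ge3$, the Yokonuma--Temperley--Lieb algebra is ${\rm YTL}_{d,n}(u):={\rm Y}_{d,n}(u)/I$, where $I$ is the two-sided ideal generated by all $g_{i,j}$ with $|i-j|=1$. Markov trace (a known theorem of Juyumaya): for given parameters $z,x_1,\dots,x_{d-1}$ there is a unique linear map ${\rm tr}$ on $\bigcup_{m\ge1}{\rm Y}_{d,m}(u)$ such that, for all $m$ and all $a,b\in{\rm Y}_{d,m}(u)$: ${\rm tr}(ab)={\rm tr}(ba)$; ${\rm tr}(1)=1$;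 ${\rm tr}(ag_m)=z\,{\rm tr}(a)$; ${\rm tr}(at_{m+1}^s)=x_s{\rm tr}(a)$ for $s=1,\dots,d-1$. The parameters are here specialized to $z\in K$, $x_i\in\mathbb{C}$, so ${\rm tr}$ takes values in $K$. ''${\rm tr}$ passes to the quotient ${\rm YTL}_{d,n}(u)$'' means that ${\rm tr}$ restricted to ${\rm Y}_{d,n}(u)$ vanishes on $I$. The ${\rm E}$-system (indices of $x$ modulo $d$, $x_0=1$) is the system $\sum_{s=0}^{d-1}x_{m+s}x_{d-s}=x_m\sum_{s=0}^{d-1}x_sx_{d-s}$ for $1\le m\le d-1$. *)

(* Defs.v *)
From HB Require Import structures.
From mathcomp Require Import all_boot all_order all_algebra.
From mathcomp Require Import complex generic_quotient ring_quotient.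
From mathcomp Require Import boolp reals trigo.
From mathcomp Require Import monalg.

Set Implicit Arguments.
Unset Strict Implicit.
Unset Printing Implicit Defensive.

Import GRing.Theory.
Local Open Scope ring_scope.
Local Open Scope quotient_scope.

Section FreeAlgebra.
Variables (K : fieldType) (I : choiceType).

Definition freeAlg : Type := {malg K[{fmonom I}]}.

HB.instance Definition _ := GRing.Lalgebra.on freeAlg.

Lemma malg_mulC (c : K) (x : {malg K[{fmonom I}]}) : x * c%:MP = c *: x.
Proof.
rewrite -mul_malgC [LHS]fgmulgU [RHS]fgmulUg.
by apply: eq_bigr => k _; rewrite mulrC mul1m mulm1.
Qed.

Lemma freeAlg_scalerAr (c : K) (x y : freeAlg) : c *: (x * y) = x * (c *: y).
Proof.
have h (x' y' : {malg K[{fmonom I}]}) : c *: (x' * y') = x' * (c *: y').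
  by have := mulrA x' c%:MP y'; rewrite malg_mulC mul_malgC scalerAl => ->.
exact: h.
Qed.

HB.instance Definition _ := GRing.Lalgebra_isAlgebra.Build K freeAlg
  freeAlg_scalerAr.

Definition freeVar (i : I) : freeAlg := << fmu i >>.

Section Lift.
Variables (A : algType K) (f : I -> A).

Definition free_eval (m : {fmonom I}) : A := \prod_(i <- (m : seq I)) f i.

Lemma free_eval_mmorphism : mmorphism free_eval.
Proof.
by split=> [a b|]; rewrite /free_eval ?fmM ?big_cat // fm1 big_nil.
Qed.

HB.instance Definition _ :=
  isMultiplicative.Build {fmonom I} A free_eval free_eval_mmorphism.

Definition free_lift (x : freeAlg) : A := mmap (in_alg A) free_eval x.

Lemma free_lift_is_additive : zmod_morphism free_lift.
Proof. exact: mmap_is_additive. Qed.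

HB.instance Definition _ :=
  GRing.isZmodMorphism.Build freeAlg A free_lift free_lift_is_additive.

Lemma free_lift_is_multiplicative : monoid_morphism free_lift.
Proof.
have [hM h1] : multiplicative free_lift.
  apply: commr_mmap_is_multiplicative => g m m'.
  by rewrite /GRing.comm /= mulr_algl mulr_algr.
by split.
Qed.

HB.instance Definition _ :=
  GRing.isMonoidMorphism.Build freeAlg A free_lift free_lift_is_multiplicative.

Lemma free_lift_is_scalable : scalable free_lift.
Proof. by move=> c x; rewrite /free_lift mmapZ /= mulr_algl. Qed.

HB.instance Definition _ :=
  GRing.isScalable.Build K freeAlg A *:%R free_lift free_lift_is_scalable.

Lemma free_liftE i : free_lift (freeVar i) = f i.
Proof.
by rewrite /free_lift /freeVar mmapU /= scale1r mul1r /free_eval fmU big_seq1.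
Qed.

End Lift.
End FreeAlgebra.

Section GeneratedIdeal.
Variables (K : fieldType) (A : algType K).

Inductive ideal_gen (S : A -> Prop) : A -> Prop :=
| ideal_gen_mem x of S x : ideal_gen S x
| ideal_gen0 : ideal_gen S 0
| ideal_genB x y of ideal_gen S x & ideal_gen S y : ideal_gen S (x - y)
| ideal_genMl a x of ideal_gen S x : ideal_gen S (a * x)
| ideal_genMr a x of ideal_gen S x : ideal_gen S (x * a).

Lemma ideal_gen_morph (B : algType K) (f : {lrmorphism A -> B}) S x :
  (forall s, S s -> f s = 0) -> ideal_gen S x -> f x = 0.
Proof.
move=> fS; elim=> {x} [x /fS //||x y _ fx _ fy|a x _ fx|a x _ fx].
- exact: rmorph0.
- by rewrite rmorphB /= fx fy subrr.
- by rewrite rmorphM /= fx mulr0.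
- by rewrite rmorphM /= fx mul0r.
Qed.

Variable S : A -> Prop.

Definition ideal_pred : {pred A} := fun x => `[< ideal_gen S x >].

Lemma ideal_predP x : reflect (ideal_gen S x) (x \in ideal_pred).
Proof. exact: asboolP. Qed.

Lemma ideal_pred_zmod : zmod_closed ideal_pred.
Proof.
split; first exact/ideal_predP/ideal_gen0.
by move=> x y /ideal_predP Sx /ideal_predP Sy; exact/ideal_predP/ideal_genB.
Qed.

HB.instance Definition _ := GRing.isZmodClosed.Build A ideal_pred
  ideal_pred_zmod.

(* The proof of properness is an index because MathComp algebras are
   nontrivial by definition. *)
Definition algQuot (nt : ~ ideal_gen S 1) : Type := Quotient.quot ideal_pred.

Section Structure.
Variable nt : ~ ideal_gen S 1.
Local Notation Q := (algQuot nt).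

HB.instance Definition _ := Choice.on Q.
HB.instance Definition _ := EqQuotient.on Q.
HB.instance Definition _ := GRing.Zmodule.on Q.

Definition algPi (x : A) : Q := \pi_Q x.
Definition algRepr (q : Q) : A := repr q.

Lemma algReprK : cancel algRepr algPi.
Proof. exact: reprK. Qed.

Lemma algPi_eq x y : algPi x = algPi y <-> ideal_gen S (x - y).
Proof.
have E := Quotient.idealrBE ideal_pred x y.
split=> [/eqP xy|xy]; first by apply/ideal_predP; rewrite E.
by move/ideal_predP: xy; rewrite E => /eqP.
Qed.

Lemma algPi_repr x : ideal_gen S (x - algRepr (algPi x)).
Proof. by apply/algPi_eq; rewrite algReprK. Qed.

Lemma algPi_is_additive : zmod_morphism algPi.
Proof. by move=> x y; rewrite /algPi raddfB. Qed.

HB.instance Definition _ := GRing.isZmodMorphism.Build A Q algPi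
  algPi_is_additive.

Definition algQuot_one : Q := lift_cst Q 1.
Definition algQuot_mul : Q -> Q -> Q := lift_op2 Q *%R.
Definition algQuot_scale (c : K) : Q -> Q := lift_op1 Q ( *:%R c).

Lemma algQuot_oneE : algQuot_one = algPi 1.
Proof. by rewrite /algQuot_one; unlock. Qed.

Lemma algQuot_mulE p q : algQuot_mul p q = algPi (algRepr p * algRepr q).
Proof. by rewrite /algQuot_mul; unlock. Qed.

Lemma algQuot_scaleE c q : algQuot_scale c q = algPi (c *: algRepr q).
Proof. by rewrite /algQuot_scale; unlock. Qed.

Lemma algPiM_subproof x y : algPi (x * y) = algQuot_mul (algPi x) (algPi y).
Proof.
rewrite algQuot_mulE.
apply/algPi_eq; set x' := algRepr _; set y' := algRepr _.
have -> : x * y - x' * y' = (x - x') * y - x' * (y' - y).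
  by rewrite mulrBl mulrBr opprB addrA subrK.
apply: ideal_genB; first exact/ideal_genMr/algPi_repr.
by apply: ideal_genMl; apply/algPi_eq; rewrite algReprK.
Qed.

Lemma algPiZ_subproof c x : algPi (c *: x) = algQuot_scale c (algPi x).
Proof.
rewrite algQuot_scaleE; apply/algPi_eq; rewrite -scalerBr -mulr_algl.
exact/ideal_genMl/algPi_repr.
Qed.

Let piP (P : Q -> Prop) : (forall x, P (algPi x)) -> forall q, P q.
Proof. by move=> h q; rewrite -[q]algReprK. Qed.

Lemma algQuot_mulA : associative algQuot_mul.
Proof.
elim/piP=> x; elim/piP=> y; elim/piP=> z.
by rewrite -!algPiM_subproof mulrA.
Qed.

Lemma algQuot_mul1 : left_id algQuot_one algQuot_mul.
Proof. by elim/piP=> x; rewrite algQuot_oneE -algPiM_subproof mul1r. Qed.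

Lemma algQuot_1mul : right_id algQuot_one algQuot_mul.
Proof. by elim/piP=> x; rewrite algQuot_oneE -algPiM_subproof mulr1. Qed.

Lemma algQuot_mulDl : left_distributive algQuot_mul +%R.
Proof.
elim/piP=> x; elim/piP=> y; elim/piP=> z.
by rewrite -raddfD -!algPiM_subproof -raddfD mulrDl.
Qed.

Lemma algQuot_mulDr : right_distributive algQuot_mul +%R.
Proof.
elim/piP=> x; elim/piP=> y; elim/piP=> z.
by rewrite -raddfD -!algPiM_subproof -raddfD mulrDr.
Qed.

Lemma algQuot_1neq0 : algQuot_one != 0.
Proof.
apply/eqP; rewrite algQuot_oneE -[0](raddf0 algPi) => /algPi_eq.
by rewrite subr0.
Qed.

HB.instance Definition _ := GRing.Zmodule_isNzRing.Build Q
  algQuot_mulA algQuot_mul1 algQuot_1mul algQuot_mulDl algQuot_mulDr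
  algQuot_1neq0.

Lemma algPi_is_multiplicative : monoid_morphism algPi.
Proof. split=> [|x y]; [exact/esym/algQuot_oneE | exact: algPiM_subproof]. Qed.

HB.instance Definition _ := GRing.isMonoidMorphism.Build A Q algPi
  algPi_is_multiplicative.

Lemma algQuot_scaleA a b q :
  algQuot_scale a (algQuot_scale b q) = algQuot_scale (a * b) q.
Proof. by elim/piP: q => x; rewrite -!algPiZ_subproof scalerA. Qed.

Lemma algQuot_scale1 : left_id 1 algQuot_scale.
Proof. by elim/piP=> x; rewrite -algPiZ_subproof scale1r. Qed.

Lemma algQuot_scaleDr : right_distributive algQuot_scale +%R.
Proof.
move=> c; elim/piP=> x; elim/piP=> y.
by rewrite -raddfD -!algPiZ_subproof -raddfD scalerDr.
Qed.

Lemma algQuot_scaleDl q : {morph algQuot_scale^~ q : a b / a + b}.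
Proof.
by elim/piP: q => x a b; rewrite -!algPiZ_subproof -raddfD scalerDl.
Qed.

HB.instance Definition _ := GRing.Zmodule_isLmodule.Build K Q
  algQuot_scaleA algQuot_scale1 algQuot_scaleDr algQuot_scaleDl.

Lemma algPi_is_scalable : scalable algPi.
Proof. exact: algPiZ_subproof. Qed.

HB.instance Definition _ := GRing.isScalable.Build K A Q *:%R algPi
  algPi_is_scalable.

Lemma algQuot_scaleAl (c : K) (p q : Q) : c *: (p * q) = (c *: p) * q.
Proof.
elim/piP: p => x; elim/piP: q => y.
by rewrite -rmorphM -!linearZ -rmorphM scalerAl.
Qed.

HB.instance Definition _ := GRing.Lmodule_isLalgebra.Build K Q algQuot_scaleAl.

Lemma algQuot_scaleAr (c : K) (p q : Q) : c *: (p * q) = p * (c *: q).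
Proof.
elim/piP: p => x; elim/piP: q => y.
by rewrite -rmorphM -!linearZ -rmorphM scalerAr.
Qed.

HB.instance Definition _ := GRing.Lalgebra_isAlgebra.Build K Q algQuot_scaleAr.

Lemma algQuot_ind (P : Q -> Prop) : (forall x, P (algPi x)) -> forall q, P q.
Proof. exact: piP. Qed.

Section Lift.
Variables (B : algType K) (f : {lrmorphism A -> B}).
Hypothesis fS : forall s, S s -> f s = 0.

Definition quot_lift (q : Q) : B := f (algRepr q).

Lemma quot_liftE x : quot_lift (algPi x) = f x.
Proof.
apply/esym/eqP; rewrite -subr_eq0 -rmorphB; apply/eqP.
exact: ideal_gen_morph fS (algPi_repr x).
Qed.

Lemma quot_lift_additive : zmod_morphism quot_lift.
Proof.
elim/piP=> x; elim/piP=> y.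
by rewrite -raddfB !quot_liftE rmorphB.
Qed.

Lemma quot_lift_multiplicative : monoid_morphism quot_lift.
Proof.
split=> [|p q]; first by rewrite -[1](rmorph1 algPi) quot_liftE rmorph1.
by elim/piP: p => x; elim/piP: q => y; rewrite -rmorphM !quot_liftE rmorphM.
Qed.

Lemma quot_lift_scalable : scalable quot_lift.
Proof.
move=> c; elim/piP=> x.
by rewrite -linearZ !quot_liftE linearZ.
Qed.

End Lift.
End Structure.
End GeneratedIdeal.

Section YokonumaHecke.
Variables (K : fieldType) (u : K) (d : nat).

Section Relations.
Variables (A : algType K) (g t : nat -> A).

(* t_{i+1}^{-s} is written t_{i+1}^{d-s}, in view of t_{i+1}^d = 1 *)
Definition YH_e (i : nat) : A :=
  d%:R^-1 *: \sum_(s < d) t i ^+ s * t i.+1 ^+ (d - s).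

(* YH_rel n a b : "a = b" is one of the defining relations of Y_{d,n}(u) for
   g_1, .., g_{n-1} and t_1, .., t_n; indices start at 1. *)
Inductive YH_rel (n : nat) : A -> A -> Prop :=
| YH_ggC i j of (0 < i < n)%N & (0 < j < n)%N & (i.+1 < j)%N || (j.+1 < i)%N :
    YH_rel n (g i * g j) (g j * g i)
| YH_braid i of (0 < i)%N & (i.+1 < n)%N :
    YH_rel n (g i.+1 * g i * g i.+1) (g i * g i.+1 * g i)
| YH_quad i of (0 < i < n)%N :
    YH_rel n (g i ^+ 2) (1 + (u - 1) *: YH_e i + (u - 1) *: (YH_e i * g i))
| YH_ttC i j of (0 < i <= n)%N & (0 < j <= n)%N :
    YH_rel n (t i * t j) (t j * t i)
| YH_tX i of (0 < i <= n)%N : YH_rel n (t i ^+ d) 1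
| YH_gt_i i of (0 < i < n)%N : YH_rel n (g i * t i) (t i.+1 * g i)
| YH_gt_iS i of (0 < i < n)%N : YH_rel n (g i * t i.+1) (t i * g i)
| YH_gt_j i j of (0 < i < n)%N & (0 < j <= n)%N & j != i & j != i.+1 :
    YH_rel n (g i * t j) (t j * g i).

End Relations.

Lemma YH_rel_morph (A B : algType K) (f : {lrmorphism A -> B}) n
    (g t : nat -> A) (g' t' : nat -> B) a b :
    (forall i, (0 < i < n)%N -> f (g i) = g' i) ->
    (forall i, (0 < i <= n)%N -> f (t i) = t' i) ->
  YH_rel g t n a b -> YH_rel g' t' n (f a) (f b).
Proof.
move=> fg ft.
have tW i : (0 < i < n)%N -> (0 < i <= n)%N /\ (0 < i.+1 <= n)%N.
  by case/andP=> i0 iltn; rewrite i0 (ltnW iltn).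
have fe i : (0 < i < n)%N -> f (YH_e t i) = YH_e t' i.
  move=> /tW[ri1 ri2]; rewrite /YH_e linearZ rmorph_sum; congr (_ *: _).
  apply: eq_bigr => s _; rewrite rmorphM !rmorphXn /=.
  by rewrite (ft _ ri1) (ft _ ri2).
case=> {a b} [i j ri rj rij|i i0 iltn|i ri|i j ri rj|i ri|i ri|i ri
             |i j ri rj ji jSi].
- by rewrite !rmorphM /= !fg //; exact: YH_ggC.
- have ri : (0 < i < n)%N by rewrite i0 ltnW.
  have riS : (0 < i.+1 < n)%N by [].
  by rewrite !rmorphM /= (fg _ ri) (fg _ riS); exact: YH_braid.
- have fZ c x : f (c *: x) = c *: f x by exact: linearZ.
  rewrite rmorphXn !rmorphD rmorph1 /= (fZ _ (YH_e t i)) (fZ _ (_ * _)) rmorphM /=.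
  by rewrite (fe _ ri) (fg _ ri); exact: YH_quad.
- by rewrite !rmorphM /= !ft //; exact: YH_ttC.
- by rewrite rmorphXn rmorph1 /= ft //; exact: YH_tX.
- case/tW: (ri) => ri1 ri2.
  by rewrite !rmorphM /= (fg _ ri) (ft _ ri1) (ft _ ri2); exact: YH_gt_i.
- case/tW: (ri) => ri1 ri2.
  by rewrite !rmorphM /= (fg _ ri) (ft _ ri1) (ft _ ri2); exact: YH_gt_iS.
- by rewrite !rmorphM /= fg // ft //; exact: YH_gt_j.
Qed.

Lemma YH_rel_image (A B : algType K) (f : {lrmorphism A -> B}) n
    (g t : nat -> A) :
    (forall a b, YH_rel g t n a b -> f a = f b) ->
  forall a b, YH_rel (f \o g) (f \o t) n a b -> a = b.
Proof.
move=> fP.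
have fZ c x : f (c *: x) = c *: f x by exact: linearZ.
have fe i : f (YH_e t i) = YH_e (f \o t) i.
  rewrite /YH_e fZ rmorph_sum; congr (_ *: _).
  by apply: eq_bigr => s _; rewrite rmorphM !rmorphXn.
move=> a b; case=> {a b} [i j ri rj rij|i i0 iltn|i ri|i j ri rj|i ri|i ri
                         |i ri|i j ri rj ji jSi] /=.
- by have /fP := YH_ggC g t ri rj rij; rewrite !rmorphM.
- by have /fP := YH_braid g t i0 iltn; rewrite !rmorphM.
- have /fP := YH_quad g t ri; rewrite rmorphXn !rmorphD rmorph1 /=.
  by rewrite (fZ _ (YH_e _ i)) (fZ _ (_ * _)) rmorphM /= fe.
- by have /fP := YH_ttC g t ri rj; rewrite !rmorphM.
- by have /fP := YH_tX g t ri; rewrite rmorphXn rmorph1.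
- by have /fP := YH_gt_i g t ri; rewrite !rmorphM.
- by have /fP := YH_gt_iS g t ri; rewrite !rmorphM.
- by have /fP := YH_gt_j g t ri rj ji jSi; rewrite !rmorphM.
Qed.

Section Algebra.
Variable n : nat.

Definition YH_gen : choiceType :=
  ({i : nat | (0 < i < n)%N} + {j : nat | (0 < j <= n)%N})%type.

Definition YH_free := freeAlg K YH_gen.

(* out of range, the free variables take the junk value 0 *)
Definition YH_gvar (i : nat) : YH_free :=
  if insub i is Some k then freeVar K (inl k : YH_gen) else 0.
Definition YH_tvar (j : nat) : YH_free :=
  if insub j is Some k then freeVar K (inr k : YH_gen) else 0.

Definition YH_relator (x : YH_free) : Prop :=
  exists2 ab, YH_rel YH_gvar YH_tvar n ab.1 ab.2 & x = ab.1 - ab.2.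

Section Lift.
Variables (B : algType K) (g t : nat -> B).

Definition YH_free_lift : YH_free -> B :=
  free_lift (fun i : YH_gen =>
    match i with inl k => g (val k) | inr k => t (val k) end).

HB.instance Definition _ := GRing.LRMorphism.on YH_free_lift.

Lemma YH_free_lift_g i : (0 < i < n)%N -> YH_free_lift (YH_gvar i) = g i.
Proof.
by move=> ri; rewrite /YH_gvar insubT /YH_free_lift free_liftE.
Qed.

Lemma YH_free_lift_t i : (0 < i <= n)%N -> YH_free_lift (YH_tvar i) = t i.
Proof.
by move=> ri; rewrite /YH_tvar insubT /YH_free_lift free_liftE.
Qed.

Lemma YH_free_lift_rel a b : YH_rel YH_gvar YH_tvar n a b ->
  YH_rel g t n (YH_free_lift a) (YH_free_lift b).
Proof. exact: YH_rel_morph YH_free_lift_g YH_free_lift_t. Qed.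

Hypothesis gtP : forall a b, YH_rel g t n a b -> a = b.

Lemma YH_free_lift_relator x : YH_relator x -> YH_free_lift x = 0.
Proof.
case=> -[a b] /= /YH_free_lift_rel /gtP ab ->.
by rewrite rmorphB; apply/eqP; rewrite subr_eq0; apply/eqP.
Qed.

End Lift.

(* g_i |-> -1, t_j |-> 1 is a character of the presentation *)
Lemma YH_nontrivial : ~ ideal_gen YH_relator 1.
Proof.
move=> I1; pose m1 (_ : nat) : K^o := -1; pose p1 (_ : nat) : K^o := 1.
have : YH_free_lift m1 p1 1 = 0.
  apply: (ideal_gen_morph (f := YH_free_lift m1 p1) _ I1).
  apply: YH_free_lift_relator => a b [] //= *.
  - by rewrite /m1 sqrrN expr1n mulrN1 scalerN addrK.
  - by rewrite expr1n.
  - by rewrite /m1 /p1 mulr1 mul1r.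
  - by rewrite /m1 /p1 mulr1 mul1r.
  - by rewrite /m1 /p1 mulr1 mul1r.
by rewrite rmorph1; apply/eqP/oner_neq0.
Qed.

Definition YH : Type := algQuot YH_nontrivial.
HB.instance Definition _ := GRing.Algebra.on YH.

Definition YHg (i : nat) : YH := algPi YH_nontrivial (YH_gvar i).
Definition YHt (j : nat) : YH := algPi YH_nontrivial (YH_tvar j).

Lemma YH_pi_rel a b : YH_rel YH_gvar YH_tvar n a b ->
  algPi YH_nontrivial a = algPi YH_nontrivial b.
Proof. by move=> r; apply/algPi_eq/ideal_gen_mem; exists (a, b). Qed.

Lemma YH_relP a b : YH_rel YHg YHt n a b -> a = b.
Proof. exact: (YH_rel_image (f := algPi YH_nontrivial) YH_pi_rel). Qed.

Definition YH_gij (i j : nat) : YH :=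
  1 + YHg i + YHg j + YHg i * YHg j + YHg j * YHg i + YHg i * YHg j * YHg i.

(* YTL_{d,n}(u) is the quotient of Y_{d,n}(u) by this ideal *)
Definition YTL_ideal : YH -> Prop :=
  ideal_gen (fun y => exists i j,
    [/\ (0 < i < n)%N, (0 < j < n)%N, (i == j.+1) || (j == i.+1)
      & y = YH_gij i j]).

End Algebra.

Section Inclusion.
Variable n : nat.

Lemma YH_rel_widen (A : algType K) (g t : nat -> A) a b :
  YH_rel g t n a b -> YH_rel g t n.+1 a b.
Proof.
have wl i : (0 < i < n)%N -> (0 < i < n.+1)%N by case/andP=> -> /ltnW.
have wle i : (0 < i <= n)%N -> (0 < i <= n.+1)%N by case/andP=> -> /leqW.
case=> {a b} [i j /wl ri /wl rj rij|i i0 iltn|i /wl ri|i j /wle ri /wle rj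
             |i /wle ri|i /wl ri|i /wl ri|i j /wl ri /wle rj ji jSi].
- exact: YH_ggC.
- by apply: YH_braid => //; exact: ltnW.
- exact: YH_quad.
- exact: YH_ttC.
- exact: YH_tX.
- exact: YH_gt_i.
- exact: YH_gt_iS.
- exact: YH_gt_j.
Qed.

Lemma YH_incl_subproof (x : YH_free n) : YH_relator x ->
  YH_free_lift (YHg n.+1) (YHt n.+1) x = 0.
Proof.
by apply: YH_free_lift_relator => a b /YH_rel_widen; exact: YH_relP.
Qed.

(* the natural map Y_{d,n}(u) -> Y_{d,n+1}(u), g_i |-> g_i, t_j |-> t_j *)
Definition YH_incl : YH n -> YH n.+1 :=
  @quot_lift _ _ _ (@YH_nontrivial n) _
    (YH_free_lift (n := n) (YHg n.+1) (YHt n.+1)).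

HB.instance Definition _ := GRing.isZmodMorphism.Build (YH n) (YH n.+1)
  YH_incl (@quot_lift_additive _ _ _ (@YH_nontrivial n) _ _ YH_incl_subproof).
HB.instance Definition _ := GRing.isMonoidMorphism.Build (YH n) (YH n.+1)
  YH_incl (@quot_lift_multiplicative _ _ _ (@YH_nontrivial n) _ _ YH_incl_subproof).
HB.instance Definition _ := GRing.isScalable.Build K (YH n) (YH n.+1) *:%R
  YH_incl (@quot_lift_scalable _ _ _ (@YH_nontrivial n) _ _ YH_incl_subproof).

Lemma YH_incl_g i : (0 < i < n)%N -> YH_incl (YHg n i) = YHg n.+1 i.
Proof.
move=> ri; rewrite -(@YH_free_lift_g n _ (YHg n.+1) (YHt n.+1) i ri).
exact: (@quot_liftE _ _ _ (@YH_nontrivial n) _ _ YH_incl_subproof).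
Qed.

Lemma YH_incl_t i : (0 < i <= n)%N -> YH_incl (YHt n i) = YHt n.+1 i.
Proof.
move=> ri; rewrite -(@YH_free_lift_t n _ (YHg n.+1) (YHt n.+1) i ri).
exact: (@quot_liftE _ _ _ (@YH_nontrivial n) _ _ YH_incl_subproof).
Qed.

End Inclusion.

(* A linear map on the union (direct limit) of the Y_{d,m}(u), m >= 1, is a
   family of linear maps compatible with the natural maps
   Y_{d,m}(u) -> Y_{d,m+1}(u); the member of index 0 plays no role. *)
Record is_markov_trace (z : K) (x : nat -> K)
    (tr : forall m : nat, {scalar YH m}) : Prop := IsMarkovTrace {
  markov_incl : forall m (a : YH m), (0 < m)%N ->
    tr m.+1 (YH_incl a) = tr m a;
  markov_mulC : forall m (a b : YH m), (0 < m)%N ->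
    tr m (a * b) = tr m (b * a);
  markov_1 : forall m, (0 < m)%N -> tr m 1 = 1;
  markov_g : forall m (a : YH m), (0 < m)%N ->
    tr m.+1 (YH_incl a * YHg m.+1 m) = z * tr m a;
  markov_t : forall m (a : YH m) s, (0 < m)%N -> (0 < s < d)%N ->
    tr m.+1 (YH_incl a * YHt m.+1 m.+1 ^+ s) = x s * tr m a
}.

Definition passes_to_YTL n (tr : {scalar YH n}) : Prop :=
  forall y : YH n, YTL_ideal y -> tr y = 0.

End YokonumaHecke.

Section ESystem.
Variables (C : fieldType) (d : nat) (x : nat -> C).

Definition E_system : Prop :=
  forall m, (1 <= m <= d.-1)%N ->
    \sum_(s < d) x ((m + s) %% d)%N * x ((d - s) %% d)%N =
    x m * \sum_(s < d) x s * x ((d - s) %% d)%N.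

End ESystem.

Section Coefficients.
Variable R : realType.

(* K = C(u) with C = R[i], its indeterminate u, and the embedding C -> K *)
Definition Cfrac : fieldType := {fraction {poly R[i]}}.
Definition Cfrac_u : Cfrac := tofrac ('X : {poly R[i]}).
Definition Cfrac_const (c : R[i]) : Cfrac := tofrac (c%:P).

Definition expd (d : nat) (k : int) : R[i] :=
  let theta : R := 2 * pi * k%:~R / d%:R in
  Complex (cos theta) (sin theta).

End Coefficients.

(* Main.v *)
Require Import Defs.
From mathcomp Require Import all_boot all_order all_algebra.
From mathcomp Require Import complex reals.
From HB Require Import structures.
From mathcomp Require Import trigo monalg ring lra.

Set Implicit Arguments.
Unset Strict Implicit.
Unset Printing Implicit Defensive.

Import Order.TTheory GRing.Theory Num.Theory.
Local Open Scope ring_scope.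

(** The two-sided ideal is generated by the conjugates of one element
    g_{1,2}, so the trace vanishes on it exactly when tr (c * g_{1,2}) = 0 for
    every c in the algebra on n strands.  The proof turns this into a system
    of scalar equations and solves the system by Fourier analysis on Z/d.

    Reduction to scalars ([passes_to_YTLP]).  For n > 3 the algebra on n
    strands is spanned by the elements a t_n^s and a g_(n-1) b with a and b
    coming from n - 1 strands ([jones_spanT]), and the Markov rules then
    replace c by an element on n - 1 strands; by induction one may take n = 3.
    There g_i g_{1,2} = (1 + (u - 1) e_i) g_{1,2}, and e_i is a combination of
    framings t^s, so only the elements c = t_1^a t_2^b t_3^c remain.  Their
    trace against g_{1,2} is a short computation ([tr3_gij]) whose outcome,
    [trace_value], is a polynomial in z, u and the x_k, with k modulo d:

      x_a x_b x_c + z (x_{a+b} x_c + x_a x_{b+c} + x_{a+c} x_b)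
        + (u + 1) z^2 x_m + (u - 1) z E_m,     m = a + b + c,

    where E_m is the mean over s of x_{m+s} x_{-s}.  Hence the trace passes to
    the quotient iff this vanishes for all a, b, c.

    Solution of the system ([trace_value_eq0P]).  Let w be a primitive d-th
    root of unity and write x_k as the sum over i of y_i w^(i k); then E_m has
    the Fourier coefficients y_i^2.  Since the characters of Z/d are linearly
    independent in each of the variables a, b and c, the system splits into

      y_i (y_j y_k + z (D_ij y_k + D_jk y_j + D_ik y_j)
                   + D_ij D_ik ((u + 1) z^2 + (u - 1) z y_i)) = 0

    for all i, j, k, with D the Kronecker symbol ([trace_value_fourier]).
    Pairwise different i, j, k show that at most two coefficients are nonzero.
    If there are two, the equations with j = k or j = i force both to be - z;
    as the y_i sum to x_0 = 1, both are 1/2 and z = - 1/2.  If there is one, it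
    is 1, and i = j = k gives (1 + z) (1 + (u + 1) z) = 0.  These are the two
    families of the theorem.  In both, all nonzero y_i are equal, so the
    convolution square of x is a multiple of x, and that is the E-system
    ([E_system_of_convolution]). *)

(** * Fourier analysis on Z/d *)

Section Fourier.
Variables (F : fieldType) (d : nat) (w : F).
Hypothesis wd : d.-primitive_root w.

Local Notation d_gt0 := (prim_order_gt0 wd).

Lemma prim_root_expX i : w ^+ i ^+ d = 1.
Proof. by rewrite exprAC (prim_expr_order wd) expr1n. Qed.

Lemma prim_rootX_neq0 i : w ^+ i != 0.
Proof.
apply/eqP => wi0; have /eqP := prim_root_expX i.
by rewrite wi0 expr0n gtn_eqF ?d_gt0 // eq_sym oner_eq0.
Qed.

(** A geometric series: for i <> j the ratio w^i / w^j is a d-th root of unity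
    other than 1. *)
Lemma prim_root_sum (i j : 'I_d) :
  \sum_(s < d) (w ^+ i / w ^+ j) ^+ s = (if i == j then d%:R else 0) :> F.
Proof.
have wj := prim_rootX_neq0 j.
case: eqVneq => [->|ij].
  rewrite divff // (eq_bigr (fun=> 1)) ?sumr_const ?card_ord // => s _.
  by rewrite expr1n.
have q1 : w ^+ i / w ^+ j - 1 != 0.
  rewrite subr_eq0; apply: contra ij => /eqP E.
  have : w ^+ i == w ^+ j by rewrite -[w ^+ i](divfK wj) E mul1r.
  by rewrite (eq_prim_root_expr wd) !modn_small.
apply: (mulfI q1); rewrite mulr0 -subrX1 exprMn exprVn !prim_root_expX.
by rewrite invr1 mulr1 subrr.
Qed.

Hypothesis dF : d%:R != 0 :> F.

(** Linear independence of characters, by orthogonality: multiply the a-th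
    relation by w^(- j a) and sum over a. *)
Lemma characters_free (c : 'I_d -> F) :
  (forall a : nat, \sum_(i < d) c i * w ^+ i ^+ a = 0) -> forall i, c i = 0.
Proof.
move=> c0 j; apply: (mulfI dF); rewrite mulr0.
have <- : \sum_(i < d) c i * \sum_(s < d) (w ^+ i / w ^+ j) ^+ s = d%:R * c j.
  rewrite (bigD1 j) //= prim_root_sum eqxx mulrC big1 ?addr0 // => i ij.
  by rewrite prim_root_sum (negPf ij) mulr0.
under eq_bigr do rewrite big_distrr.
rewrite exchange_big big1 // => s _.
under eq_bigr do rewrite /= expr_div_n mulrA.
by rewrite -big_distrl /= c0 mul0r.
Qed.

Lemma fourier_inversion (X : nat -> F) : (forall k, X k = X (k %% d)%N) ->
  exists y : 'I_d -> F, forall k, X k = \sum_(i < d) y i * w ^+ i ^+ k.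
Proof.
move=> Xmod.
exists (fun i => d%:R^-1 * \sum_(s < d) X s / w ^+ i ^+ s) => k.
rewrite Xmod.
have -> : \sum_(i < d) d%:R^-1 * (\sum_(s < d) X s / w ^+ i ^+ s) * w ^+ i ^+ k
  = d%:R^-1 * \sum_(s < d) X s * \sum_(i < d) (w ^+ (k %% d) / w ^+ s) ^+ i.
  rewrite big_distrr /=.
  under [RHS]eq_bigr do rewrite big_distrr big_distrr /=.
  rewrite exchange_big; apply: eq_bigr => i _ /=.
  rewrite -mulrA big_distrl big_distrr; apply: eq_bigr => s _ /=.
  congr (_ * _); rewrite -mulrA; congr (_ * _).
  by rewrite expr_div_n (prim_expr_mod wd) ![w ^+ i ^+ _]exprAC mulrC.
have kd : (k %% d < d)%N by rewrite ltn_mod d_gt0.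
rewrite (bigD1 (Ordinal kd)) //= (prim_root_sum (Ordinal kd) (Ordinal kd)) eqxx.
rewrite big1 ?addr0 => [|s sk]; first by rewrite mulrCA mulVf ?mulr1.
by rewrite (prim_root_sum (Ordinal kd)) eq_sym (negPf sk) mulr0.
Qed.

(** The Fourier transform turns the convolution into the pointwise square;
    writing d - s for - s is harmless because w^i has order dividing d. *)
Lemma fourier_convolution (X : nat -> F) (y : 'I_d -> F) :
  (forall k, X k = \sum_(i < d) y i * w ^+ i ^+ k) ->
  forall m p, \sum_(s < d) X (m + s)%N * X (p + (d - s))%N =
    d%:R * \sum_(i < d) y i ^+ 2 * w ^+ i ^+ (m + p).
Proof.
move=> XE m p.
have term (i j s : 'I_d) :
    y i * w ^+ i ^+ (m + s) * (y j * w ^+ j ^+ (p + (d - s))) =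
    y i * y j * (w ^+ i ^+ m * w ^+ j ^+ p) * (w ^+ i / w ^+ j) ^+ s.
  rewrite !exprD expr_div_n exprB; last 2 first.
  - exact: ltnW.
  - by rewrite unitfE prim_rootX_neq0.
  by rewrite prim_root_expX mul1r; ring.
transitivity (\sum_(s < d) \sum_(i < d) \sum_(j < d)
    y i * y j * (w ^+ i ^+ m * w ^+ j ^+ p) * (w ^+ i / w ^+ j) ^+ s).
  apply: eq_bigr => s _; rewrite !XE big_distrlr /=.
  by apply: eq_bigr => i _; apply: eq_bigr => j _; apply: term.
rewrite exchange_big big_distrr; apply: eq_bigr => i _ /=.
rewrite exchange_big (bigD1 i) //= -big_distrr /= prim_root_sum eqxx.
rewrite big1 ?addr0 => [|j ji]; first by rewrite exprD; ring.
by rewrite -big_distrr /= prim_root_sum eq_sym (negPf ji) mulr0.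
Qed.

End Fourier.

(** * The trace equations and their solutions *)

(** The value of the trace at t_1^a t_2^b t_3^c g_{1,2}, see [tr3_gij], where
    X k stands for the parameter x_(k mod d).  The last sum comes from the
    quadratic relation, applied to the square of g_1 that appears when the
    Markov rule removes g_2 from g_1 g_2 g_1. *)
Definition trace_value (F : fieldType) (u z : F) d (X : nat -> F) a b c : F :=
  X a * X b * X c
  + z * (X (a + b)%N * X c + X a * X (b + c)%N + X (a + c)%N * X b)
  + (u + 1) * z ^+ 2 * X (a + b + c)%N
  + (u - 1) * z * (d%:R^-1 * \sum_(s < d) X (a + c + s)%N * X (b + (d - s))%N).

Section Solutions.
Variables (F : fieldType) (d : nat) (w : F).
Hypothesis wd : d.-primitive_root w.
Hypothesis dF : d%:R != 0 :> F.
Variables (u z : F) (X : nat -> F) (y : 'I_d -> F).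
Hypothesis XE : forall k, X k = \sum_(i < d) y i * w ^+ i ^+ k.
Local Notation D i j := ((i == j)%:R : F).
Local Notation C i := ((u + 1) * z ^+ 2 + (u - 1) * z * y i).

(** Expanding w^(i b) over all characters puts the terms of the trace equations
    that carry a fixed character on the same footing as the other terms. *)
Lemma delta_sum (i : 'I_d) b : w ^+ i ^+ b = \sum_(j < d) D i j * w ^+ j ^+ b.
Proof.
rewrite (bigD1 i) //= eqxx mul1r big1 ?addr0 // => j ji.
by rewrite eq_sym (negPf ji) mul0r.
Qed.

(** The equations are compared character by character, first in the variable
    a, then in b, then in c; the coefficients of the characters with indices
    i, j and k are the displayed expressions. *)
Lemma trace_value_fourier :
  (forall a b c, trace_value u z d X a b c = 0) ->
  forall i j k, y i * (y j * y k + z * (D i j * y k + D j k * y j + D i k * y j)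
      + D i j * D i k * C i) = 0.
Proof.
move=> E i.
have E1 b c : y i * (X b * X c
    + z * (w ^+ i ^+ b * X c + X (b + c)%N + w ^+ i ^+ c * X b)
    + C i * w ^+ i ^+ b * w ^+ i ^+ c) = 0.
  apply: (characters_free wd dF (c := fun i => y i * (X b * X c
    + z * (w ^+ i ^+ b * X c + X (b + c)%N + w ^+ i ^+ c * X b)
    + C i * w ^+ i ^+ b * w ^+ i ^+ c)) _ i) => a.
  rewrite -[RHS](E a b c) /trace_value (fourier_convolution wd XE) mulKf //.
  rewrite (XE a) (XE (a + b)) (XE (a + c)) (XE (a + b + c)).
  rewrite !mulr_suml -!big_split /= !mulr_sumr -!big_split /=.
  by apply: eq_bigr => j _; rewrite !exprD; ring.
have E2 j c : y i * (y j * X c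
    + z * (D i j * X c + y j * w ^+ j ^+ c + w ^+ i ^+ c * y j)
    + C i * D i j * w ^+ i ^+ c) = 0.
  apply: (characters_free wd dF (c := fun j => y i * (y j * X c
    + z * (D i j * X c + y j * w ^+ j ^+ c + w ^+ i ^+ c * y j)
    + C i * D i j * w ^+ i ^+ c)) _ j) => b.
  rewrite -[RHS](E1 b c) (XE b) (XE (b + c)) (delta_sum i b).
  rewrite !(mulr_suml, mulr_sumr) -!big_split /=.
  rewrite !(mulr_suml, mulr_sumr) -!big_split /= mulr_sumr.
  by apply: eq_bigr => k _; rewrite !exprD; ring.
move=> j k.
apply: (characters_free wd dF (c := fun k =>
  y i * (y j * y k + z * (D i j * y k + D j k * y j + D i k * y j)
      + D i j * D i k * C i)) _ k) => c.
rewrite -[RHS](E2 j c) (XE c) (delta_sum i c) (delta_sum j c).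
rewrite !(mulr_suml, mulr_sumr) -!big_split /=.
rewrite !(mulr_suml, mulr_sumr) -!big_split /= mulr_sumr.
by apply: eq_bigr => l _; ring.
Qed.

(** Division by a nonzero y_i leaves equations in j and k whose shape depends
    only on which of the three indices coincide. *)
Lemma trace_value_solve : X 0 = 1 ->
  (forall a b c, trace_value u z d X a b c = 0) ->
  (exists m : 'I_d,
      (forall k, X k = w ^+ m ^+ k) /\ (1 + z) * (1 + (u + 1) * z) = 0) \/
  (exists m1 m2 : 'I_d, [/\ m1 != m2,
      forall k, X k = 2^-1 * (w ^+ m1 ^+ k + w ^+ m2 ^+ k) & z = - 2^-1]).
Proof.
move=> X0 /trace_value_fourier E.
have sum1 : \sum_i y i = 1.
  by rewrite -X0 XE; apply: eq_bigr => i _; rewrite expr0 mulr1.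
have [i yi] : exists i, y i != 0.
  apply/existsP; apply: contra_eqT sum1 => /existsPn y0.
  by rewrite big1 1?eq_sym ?oner_neq0 // => i _; apply/eqP/negPn/y0.
have {}E j k : y j * y k + z * (D i j * y k + D j k * y j + D i k * y j)
      + D i j * D i k * C i = 0 by apply: (mulfI yi); rewrite mulr0.
(* Is y_i the only nonzero coefficient? *)
have [[j ji yj]|single] : (exists2 j, j != i & y j != 0) \/
    (forall j, j != i -> y j = 0).
  have [/existsP[j /andP[]]|/existsPn no] :=
    boolP [exists j, (j != i) && (y j != 0)]; first by left; exists j.
  by right=> j ji; apply/eqP/negPn; have := no j; rewrite ji.
- right; exists i, j; have zj : y j = - z.
    have := E j j; rewrite eqxx eq_sym (negPf ji) mulr1n mulr0n => H.
    by apply: (mulfI yj); apply/eqP; rewrite -subr_eq0 -H; apply/eqP; ring.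
  have zi : y i = - z.
    have := E i j; rewrite eqxx eq_sym (negPf ji) mulr1n mulr0n => H.
    by apply: (mulfI yj); apply/eqP; rewrite -subr_eq0 -H; apply/eqP; ring.
  have yk k : k != i -> k != j -> y k = 0.
    move=> ki kj; have := E j k.
    rewrite (eq_sym i k) (eq_sym j k) (eq_sym i j).
    rewrite (negPf ji) (negPf ki) (negPf kj) mulr0n => H.
    by apply: (mulfI yj); rewrite mulr0 -[RHS]H; ring.
  have two : 2 * - z = 1.
    rewrite -[RHS]sum1 (bigD1 i) //= (bigD1 j) //= big1 ?addr0.
      by rewrite zi zj; ring.
    by move=> k /andP[]; apply: yk.
  have n2 : 2 != 0 :> F.
    by apply/eqP => n2; move/eqP: two; rewrite n2 mul0r eq_sym oner_eq0.
  have z2 : - z = 2^-1 by apply: (mulfI n2); rewrite two mulfV.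
  split=> [||]; first by rewrite eq_sym.
    move=> k; rewrite XE (bigD1 i) //= (bigD1 j) //= big1 ?addr0.
      by rewrite zi zj z2 mulrDr.
    by move=> l /andP[li lj]; rewrite yk ?mul0r.
  by rewrite -z2 opprK.
- have yi1 : y i = 1 by rewrite -sum1 (bigD1 i) //= big1 ?addr0.
  left; exists i; split.
    move=> k; rewrite XE (bigD1 i) //= yi1 mul1r big1 ?addr0 // => j /single ->.
    by rewrite mul0r.
  by rewrite -[RHS](E i i) eqxx yi1 mulr1n; ring.
Qed.

(** If all nonzero Fourier coefficients of X are equal, then the convolution
    square of X is proportional to X. *)
Lemma convolution_sqr_prop c0 : (forall i, y i ^+ 2 = c0 * y i) ->
  forall m p, \sum_(s < d) X (m + s)%N * X (p + (d - s))%N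
    = d%:R * (c0 * X (m + p)%N).
Proof.
move=> yc m p; rewrite (fourier_convolution wd XE) XE; congr (_ * _).
by rewrite mulr_sumr; apply: eq_bigr => i _; rewrite yc mulrA.
Qed.

End Solutions.

Section Converse.
Variables (F : fieldType) (d : nat) (w : F).
Hypothesis wd : d.-primitive_root w.

Lemma convolution_char (m1 : 'I_d) (X : nat -> F) :
  (forall k, X k = w ^+ m1 ^+ k) ->
  forall m p, \sum_(s < d) X (m + s)%N * X (p + (d - s))%N = d%:R * X (m + p)%N.
Proof.
move=> XE m p.
have XF k : X k = \sum_i (m1 == i)%:R * w ^+ i ^+ k by rewrite XE (delta_sum w).
rewrite (convolution_sqr_prop wd XF (c0 := 1)) ?mul1r // => i.
by rewrite mul1r -natrX; case: (_ == _).
Qed.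

Lemma convolution_char2 (m1 m2 : 'I_d) (X : nat -> F) :
  (2 : F) != 0 -> m1 != m2 ->
  (forall k, X k = 2^-1 * (w ^+ m1 ^+ k + w ^+ m2 ^+ k)) ->
  forall m p, \sum_(s < d) X (m + s)%N * X (p + (d - s))%N =
    d%:R * (2^-1 * X (m + p)%N).
Proof.
move=> n2 m12 XE m p.
have XF k : X k = \sum_i (2^-1 * ((m1 == i)%:R + (m2 == i)%:R)) * w ^+ i ^+ k.
  rewrite XE !(delta_sum w _ k) -big_split mulr_sumr /=.
  by apply: eq_bigr => i _; ring.
rewrite (convolution_sqr_prop wd XF (c0 := 2^-1)) // => i.
rewrite expr2 -!mulrA; congr (_ * _).
have [<-|_] := eqVneq m1 i.
  by rewrite eq_sym (negPf m12) mulr0n addr0 !mulr1 mul1r.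
by case: (m2 == i); rewrite !add0r ?mulr1 ?mul1r ?mulr0.
Qed.

Hypothesis dF : d%:R != 0 :> F.

Lemma trace_value_char (u z : F) (m1 : 'I_d) (X : nat -> F) :
  (forall k, X k = w ^+ m1 ^+ k) -> (1 + z) * (1 + (u + 1) * z) = 0 ->
  forall a b c, trace_value u z d X a b c = 0.
Proof.
move=> XE zP a b c; rewrite /trace_value (convolution_char XE) mulKf //.
by rewrite !XE -[RHS](mulr0 (w ^+ m1 ^+ (a + b + c))) -zP !exprD; ring.
Qed.

Lemma trace_value_char2 (u z : F) (m1 m2 : 'I_d) (X : nat -> F) :
  (2 : F) != 0 -> m1 != m2 ->
  (forall k, X k = 2^-1 * (w ^+ m1 ^+ k + w ^+ m2 ^+ k)) -> z = - 2^-1 ->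
  forall a b c, trace_value u z d X a b c = 0.
Proof.
move=> n2 m12 XE -> a b c.
rewrite /trace_value (convolution_char2 n2 m12 XE) mulKf //.
by rewrite !XE !exprD; field.
Qed.

End Converse.

Lemma trace_value_eq0P (F : fieldType) (d : nat) (w : F)
    (wd : d.-primitive_root w) (dF : d%:R != 0 :> F) (n2 : (2 : F) != 0)
    (u z : F) (X : nat -> F) :
    X 0 = 1 -> (forall k, X k = X (k %% d)%N) ->
  (forall a b c, trace_value u z d X a b c = 0) <->
  (exists m : 'I_d,
      (forall k, X k = w ^+ m ^+ k) /\ (1 + z) * (1 + (u + 1) * z) = 0) \/
  (exists m1 m2 : 'I_d, [/\ m1 != m2,
      forall k, X k = 2^-1 * (w ^+ m1 ^+ k + w ^+ m2 ^+ k) & z = - 2^-1]).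
Proof.
move=> X0 Xmod; split; last first.
  case=> [[m [XE zE]]|[m1 [m2 [m12 XE zE]]]].
    exact: (trace_value_char wd dF XE zE).
  exact: (trace_value_char2 wd dF u n2 m12 XE zE).
have [y XE] := fourier_inversion wd dF Xmod.
exact: (trace_value_solve wd dF XE X0).
Qed.

Lemma linear_factors_eq0 (F : fieldType) (v z : F) : v != 0 ->
  (1 + z) * (1 + v * z) = 0 <-> z = - v^-1 \/ z = - 1.
Proof.
move=> v0; split=> [/eqP|[->|->]].
- rewrite mulf_eq0 ![1 + _]addrC !addr_eq0 => /orP[] /eqP zE; first by right.
  by left; apply: (mulfI v0); rewrite zE mulrN mulfV.
- by rewrite mulrN mulfV // subrr mulr0.
- by rewrite subrr mul0r.
Qed.

(** * Consequences of the defining relations *)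

Section Presentation.
Variables (K : fieldType) (u : K) (d n : nat) (A : algType K).
Variables (g t : nat -> A).
Hypothesis rel : forall a b, YH_rel u d g t n a b -> a = b.
Local Notation e := (YH_e d t).

Lemma intertwineX (x y y' : A) s : x * y = y' * x -> x * y ^+ s = y' ^+ s * x.
Proof.
move=> xy; elim: s => [|s IH]; first by rewrite !expr0 mulr1 mul1r.
by rewrite !exprS mulrA xy -!mulrA IH.
Qed.

Lemma gX_t i s : (0 < i < n)%N -> g i * t i ^+ s = t i.+1 ^+ s * g i.
Proof. by move=> ri; apply: intertwineX; apply/rel/YH_gt_i. Qed.

Lemma gX_tS i s : (0 < i < n)%N -> g i * t i.+1 ^+ s = t i ^+ s * g i.
Proof. by move=> ri; apply: intertwineX; apply/rel/YH_gt_iS. Qed.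

Lemma gX_tj i j s : (0 < i < n)%N -> (0 < j <= n)%N -> j != i -> j != i.+1 ->
  g i * t j ^+ s = t j ^+ s * g i.
Proof. by move=> ri rj ji jSi; apply: intertwineX; apply/rel/YH_gt_j. Qed.

Lemma tXC i j a b : (0 < i <= n)%N -> (0 < j <= n)%N ->
  t i ^+ a * t j ^+ b = t j ^+ b * t i ^+ a.
Proof.
by move=> ri rj; apply/intertwineX/esym/intertwineX/rel/YH_ttC.
Qed.

Lemma tX_d i : (0 < i <= n)%N -> t i ^+ d = 1.
Proof. by move=> ri; apply/rel/YH_tX. Qed.

Lemma range_pair i : (0 < i < n)%N -> (0 < i <= n)%N * (0 < i.+1 <= n)%N.
Proof. by case/andP=> i0 iltn; rewrite i0 iltn (ltnW iltn). Qed.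

(** The two sums differ by a cyclic shift of the exponents, and the boundary
    terms agree because both framings have order dividing d. *)
Lemma e_t_shift i : (0 < i < n)%N -> t i * e i = t i.+1 * e i.
Proof.
move=> ri; have [r1 r2] := range_pair ri.
rewrite /YH_e -!scalerAr !big_distrr /=; congr (_ *: _).
pose f s := t i ^+ s * t i.+1 ^+ (d.+1 - s).
rewrite (eq_bigr (fun s : 'I_d => f s.+1)); last first.
  by move=> s _; rewrite /f subSS mulrA -exprS.
rewrite [RHS](eq_bigr (fun s : 'I_d => f s)); last first.
  move=> s _; rewrite /f subSn; last exact: ltnW.
  rewrite -[X in X * _]expr1 mulrA (tXC 1) // -mulrA; congr (_ * _).
  by rewrite expr1 -exprS.
have f0d : f d = f 0%N.
  by rewrite /f subn0 subSnn expr0 tX_d // !mul1r expr1 exprS tX_d ?mulr1.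
apply: (addrI (f 0%N)); rewrite -(big_ord_recl d f) big_ord_recr /= f0d.
exact: addrC.
Qed.

Lemma tX_e i a : (0 < i < n)%N -> t i ^+ a * e i = t i.+1 ^+ a * e i.
Proof.
move=> ri; have [r1 r2] := range_pair ri.
elim: a => [|a IH]; first by rewrite !expr0.
rewrite exprSr -mulrA e_t_shift // mulrA -[X in _ * X * _]expr1.
by rewrite tXC // expr1 -mulrA IH mulrA -exprS.
Qed.

Hypothesis dK : d%:R != 0 :> K.

Lemma e_idem i : (0 < i < n)%N -> e i * e i = e i.
Proof.
move=> ri; have [r1 r2] := range_pair ri.
rewrite {1}/YH_e -scalerAl big_distrl /= (eq_bigr (fun=> e i)).
  by rewrite sumr_const card_ord -scaler_nat scalerA mulVf ?scale1r.
move=> s _; rewrite tXC // -mulrA tX_e // mulrA -exprD subnK; last exact: ltnW.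
by rewrite tX_d ?mul1r.
Qed.

(** Conjugation by g_i exchanges the two framings in e_i, that is, it replaces
    s by d - s in the sum; again the boundary terms agree. *)
Lemma g_e i : (0 < i < n)%N -> g i * e i = e i * g i.
Proof.
move=> ri; have [r1 r2] := range_pair ri.
rewrite /YH_e -scalerAr -scalerAl big_distrr big_distrl /=; congr (_ *: _).
pose f s := t i ^+ s * t i.+1 ^+ (d - s) * g i.
rewrite (eq_bigr (fun s : 'I_d => f (rev_ord s).+1)); last first.
  move=> s _; rewrite /f /= subnSK // mulrA gX_t //.
  rewrite -[LHS]mulrA gX_tS // mulrA.
  by rewrite tXC // subKn //; apply: ltnW.
have -> : \sum_(s < d) f (rev_ord s).+1 = \sum_(s < d) f s.+1.
  by rewrite [RHS](reindex_inj rev_ord_inj).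
have f0d : f d = f 0%N by rewrite /f subn0 subnn !expr0 !tX_d // mulr1.
apply: (addrI (f 0%N)); rewrite -(big_ord_recl d f) big_ord_recr /= f0d.
exact: addrC.
Qed.

Hypothesis u0 : u != 0.

(** The inverse of g_i: on the image of the idempotent e_i the quadratic
    relation reads g^2 = u + (u - 1) g, on its complement g^2 = 1. *)
Definition ginv i : A := g i + (u^-1 - 1) *: e i + (u^-1 - 1) *: (e i * g i).

Let quadE i : (0 < i < n)%N ->
  g i * g i = 1 + (u - 1) *: e i + (u - 1) *: (e i * g i).
Proof. by move=> ri; rewrite -expr2; apply/rel/YH_quad. Qed.

Lemma ginvE i : (0 < i < n)%N -> g i * ginv i = 1 /\ ginv i * g i = 1.
Proof.
move=> ri; have gg := quadE ri; have ge := g_e ri; have ee := e_idem ri.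
rewrite /ginv; move: (g i) (e i) gg ge ee => G E gg ge ee.
set v := u^-1; have uv : v * u = 1 by rewrite mulVf.
set H := G + _ + _.
have C : G * H = H * G.
  by rewrite /H !mulrDl !mulrDr -!scalerAl -!scalerAr -ge -mulrA -ge.
suff HG : H * G = 1 by rewrite C.
have EGG : E * (G * G) = u *: E + (u - 1) *: (E * G).
  rewrite gg !mulrDr mulr1 -!scalerAr mulrA ee.
  by rewrite -[X in X + _ *: E]scale1r -scalerDl [1 + _]addrC subrK.
rewrite /H !mulrDl -!scalerAl -mulrA EGG gg scalerDr !scalerA.
have -> : (v - 1) * u = - (u - 1) by rewrite mulrBl uv; ring.
have -> : (v - 1) * (u - 1) = - (u - 1) - (v - 1).
  by rewrite mulrBr !mulrBl uv; ring.
rewrite (scalerDl (E * G) (- (u - 1))) !scaleNr.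
move: (_ *: E) (_ *: (E * G)) ((v - 1) *: _) => p q r.
have -> : 1 + p + q + r = 1 + (p + (q + r)) by rewrite !addrA.
by rewrite -!opprD addrK.
Qed.

Definition gij i j : A :=
  1 + g i + g j + g i * g j + g j * g i + g i * g j * g i.

Lemma gij_sym i : (0 < i)%N -> (i.+1 < n)%N -> gij i.+1 i = gij i i.+1.
Proof.
move=> i0 iSn; rewrite /gij (rel (YH_braid u d g t i0 iSn)).
congr (_ + _); rewrite -!addrA; congr (_ + _).
by rewrite addrA (addrC (g i.+1)) -addrA (addrC (g i.+1 * g i)).
Qed.

(** g_{i,j} = (1 + g_i) (1 + g_j + g_j g_i), and 1 + g_i absorbs g_i up to the
    factor 1 + (u - 1) e_i by the quadratic relation. *)
Lemma g_gij i j : (0 < i < n)%N ->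
  g i * gij i j = gij i j + (u - 1) *: (e i * gij i j).
Proof.
move=> ri; have gg := quadE ri; rewrite /gij; move: (g i) (g j) (e i) gg.
move=> x y E gg.
have -> : 1 + x + y + x * y + y * x + x * y * x = (1 + x) * (1 + y + y * x).
  rewrite mulrDl mul1r !mulrDr mulr1 !mulrA !addrA; congr (_ + _).
  rewrite -!addrA; congr (_ + _).
  by rewrite [RHS]addrA [RHS]addrCA -[in RHS]addrA (addrC (y * x)).
have -> : x * ((1 + x) * (1 + y + y * x)) =
    ((1 + x) + (u - 1) *: (E * (1 + x))) * (1 + y + y * x).
  rewrite mulrA; congr (_ * _).
  rewrite mulrDr mulr1 gg mulrDr mulr1 scalerDr.
  by rewrite !addrA [x + 1]addrC -!addrA addrCA.
by rewrite mulrDl -scalerAl -mulrA.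
Qed.

(** By the braid relations h g_i = g_(i+1) h and h g_(i+1) = g_(i+2) h, so the
    generators of the ideal are conjugate to each other. *)
Lemma gij_conj i (h := g i * g i.+1 * g i.+2) : (0 < i)%N -> (i.+2 < n)%N ->
  h * gij i i.+1 = gij i.+1 i.+2 * h.
Proof.
move=> i0 iSSn; have iSn : (i.+1 < n)%N by apply: ltnW.
have b1 := rel (YH_braid u d g t i0 iSn).
have b2 := rel (YH_braid u d g t (ltn0Sn i) iSSn).
have ri : (0 < i < n)%N by rewrite i0 ltnW.
have c : g i * g i.+2 = g i.+2 * g i.
  by apply/rel/YH_ggC; rewrite // ltnSn.
have h1 : h * g i = g i.+1 * h.
  by rewrite /h -!mulrA -c !mulrA b1.
have h2 : h * g i.+1 = g i.+2 * h.
  by rewrite /h -!mulrA [g i.+1 * (_ * _)]mulrA -b2 !mulrA c.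
move: h h1 h2 => {}h h1 h2.
rewrite /gij !mulrDr !mulrDl mulr1 mul1r !mulrA h1 h2.
by rewrite -!(mulrA _ h) h1 h2 !mulrA -!(mulrA _ h) h1 !mulrA.
Qed.

End Presentation.

(** * Generation of the algebras, and traces on ideals *)

(** The free algebra is spanned by the words in its variables. *)
Lemma freeAlg_ind (K : fieldType) (I : choiceType) (P : freeAlg K I -> Prop) :
  P 1 -> (forall c x y, P x -> P y -> P (c *: x + y)) ->
  (forall i x, P x -> P (x * freeVar K i)) -> forall x, P x.
Proof.
move=> P1 PD PM x.
have P0 : P 0 by rewrite -[0](subrr 1) -scaleN1r addrC; apply: PD.
have Pk (k : {fmonom I}) : P (<< k >> : {malg K[{fmonom I}]}).
  case: k; elim/last_ind => [|s i IH].
    have -> : FMonom [::] = @mone {fmonom I} by apply/val_inj; rewrite /= fm1.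
    exact: P1.
  have -> : FMonom (rcons s i) = mmul (FMonom s) (fmu i) :> {fmonom I}.
    by apply/val_inj; rewrite /= fmM fmU cats1.
  have -> : (<< mmul (FMonom s) (fmu i) >> : {malg K[{fmonom I}]}) =
      fgmul << FMonom s >> << fmu i >> by rewrite fgmulUU mulr1.
  exact: PM.
rewrite [x]monalgE; elim: (finmap.enum_fset _) => [|k s IH].
  by rewrite big_nil; exact: P0.
rewrite big_cons.
have -> : (<< mcoeff k x *g k >> : {malg K[{fmonom I}]}) =
    mcoeff k x *: (<< k >> : {malg K[{fmonom I}]}).
  by apply/malgP => k'; rewrite mcoeffZ !mcoeffU mulrnAr mulr1.
exact: (PD _ _ _ (Pk k) IH).
Qed.

Lemma YH_ind (K : fieldType) (u : K) (d n : nat) (P : YH u d n -> Prop) :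
  P 1 -> (forall c x y, P x -> P y -> P (c *: x + y)) ->
  (forall i x, (0 < i < n)%N -> P x -> P (x * YHg u d n i)) ->
  (forall j x, (0 < j <= n)%N -> P x -> P (x * YHt u d n j)) ->
  forall x, P x.
Proof.
move=> P1 PD Pg Pt; elim/algQuot_ind.
apply: freeAlg_ind => [|c x y Px Py|[k|k] x Px].
- by rewrite rmorph1.
- by rewrite linearP; apply: PD.
- rewrite rmorphM /=.
  have -> : freeVar K (inl k : YH_gen n) = YH_gvar K n (val k).
    by rewrite /YH_gvar valK.
  exact: Pg (valP k) Px.
- rewrite rmorphM /=.
  have -> : freeVar K (inr k : YH_gen n) = YH_tvar K n (val k).
    by rewrite /YH_tvar valK.
  exact: Pt (valP k) Px.
Qed.

(** A trace vanishes on a two-sided ideal as soon as it vanishes on the left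
    multiples of the generators. *)
Lemma ideal_gen_trace (K : fieldType) (A : algType K) (S : A -> Prop)
    (tau : {scalar A}) : (forall a b, tau (a * b) = tau (b * a)) ->
  (forall a s, S s -> tau (a * s) = 0) -> forall y, ideal_gen S y -> tau y = 0.
Proof.
move=> tauC tauS y Sy; rewrite -[y]mul1r; move: 1.
elim: Sy => {y} [y /tauS //||y1 y2 _ IH1 _ IH2|b y _ IH|b y _ IH] a.
- by rewrite mulr0 linear0.
- by rewrite mulrBr linearB /= IH1 IH2 subrr.
- by rewrite mulrA.
- by rewrite mulrA tauC mulrA.
Qed.

(** * Markov traces on a tower of algebras *)

(** The arguments use nothing about the algebras but their relations, their
    inclusions and the fact that they are generated by the g_i and t_j, so they
    are carried out for an arbitrary tower with these properties. *)
Section Tower.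
Variables (K : fieldType) (u : K) (d : nat).
Hypotheses (d_gt0 : (0 < d)%N) (dK : d%:R != 0 :> K) (u0 : u != 0).
Variables (Y : nat -> algType K) (inc : forall m, {lrmorphism Y m -> Y m.+1}).
Variables (G T : forall m, nat -> Y m).
Arguments inc {m}.
Hypothesis rel : forall n a b, YH_rel u d (@G n) (@T n) n a b -> a = b.
Hypothesis inc_g : forall m i, (0 < i < m)%N -> inc (G m i) = G m.+1 i.
Hypothesis inc_t : forall m i, (0 < i <= m)%N -> inc (T m i) = T m.+1 i.
Local Notation e n := (YH_e d (@T n)).
Local Notation gg n := (gij (@G n)).

Variables (z : K) (x : nat -> K) (tr : forall m : nat, {scalar Y m}).
Hypothesis tr_inc : forall m (a : Y m), (0 < m)%N -> tr m.+1 (inc a) = tr m a.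
Hypothesis trC : forall m (a b : Y m), (0 < m)%N -> tr m (a * b) = tr m (b * a).
Hypothesis tr1 : forall m, (0 < m)%N -> tr m 1 = 1.
Hypothesis tr_g : forall m (a : Y m), (0 < m)%N ->
  tr m.+1 (inc a * G m.+1 m) = z * tr m a.
Hypothesis tr_t : forall m (a : Y m) s, (0 < m)%N -> (0 < s < d)%N ->
  tr m.+1 (inc a * T m.+1 m.+1 ^+ s) = x s * tr m a.
Hypothesis x0 : x 0 = 1.
Local Notation X k := (x (k %% d)%N).

Lemma tX_mod n i s : (0 < i <= n)%N -> T n i ^+ s = T n i ^+ (s %% d).
Proof. by move=> ri; rewrite expr_mod // (tX_d (@rel n)). Qed.

Lemma tr_tS m (a : Y m) s : (0 < m)%N ->
  tr m.+1 (inc a * T m.+1 m.+1 ^+ s) = X s * tr m a.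
Proof.
move=> m0; rewrite tX_mod ?leqnn //.
have [->|s0] := posnP (s %% d).
  by rewrite expr0 mulr1 tr_inc // x0 mul1r.
by rewrite tr_t // s0 ltn_mod.
Qed.

(** By cyclicity the Markov rule removes g_m from the middle of a product. *)
Lemma tr_g2 m (a b : Y m) : (0 < m)%N ->
  tr m.+1 (inc a * G m.+1 m * inc b) = z * tr m (b * a).
Proof. by move=> m0; rewrite trC // mulrA -rmorphM tr_g. Qed.

Lemma inc_tX m i s : (0 < i <= m)%N -> T m.+1 i ^+ s = inc (T m i ^+ s).
Proof. by move=> ri; rewrite rmorphXn /= inc_t. Qed.

(** The Markov rules only concern the framing of the last strand.  On one strand
    the trace is computed on two strands, where g_1 conjugates t_1 into t_2. *)
Lemma tr1_t s : tr 1 (T 1 1 ^+ s) = X s.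
Proof.
rewrite -tr_inc // -inc_tX //.
have [gv vg] := ginvE (@rel 2) dK u0 (isT : (0 < 1 < 2)%N).
rewrite -[T 2 1 ^+ s]mul1r -vg -mulrA (gX_t (@rel 2)) //.
rewrite trC // -mulrA gv mulr1.
by rewrite -[T 2 2 ^+ s]mul1r -(rmorph1 (@inc 1)) tr_tS // tr1 ?mulr1.
Qed.

Lemma tr2_tt a b : tr 2 (T 2 1 ^+ a * T 2 2 ^+ b) = X a * X b.
Proof. by rewrite inc_tX // tr_tS // tr1_t mulrC. Qed.

Lemma tr2_ttg a b : tr 2 (T 2 1 ^+ a * T 2 2 ^+ b * G 2 1) = z * X (a + b).
Proof.
rewrite -mulrA -(gX_t (@rel 2)) // mulrA !(@inc_tX 1) // tr_g2 //.
by rewrite -exprD tr1_t addnC.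
Qed.

Lemma ttX_e n a b i : (0 < i < n)%N ->
  T n i ^+ a * T n i.+1 ^+ b * e n i =
  d%:R^-1 *: \sum_(s < d) T n i ^+ (a + s) * T n i.+1 ^+ (b + (d - s)).
Proof.
move=> ri; have [r1 r2] := range_pair ri.
rewrite -scalerAr big_distrr; congr (_ *: _); apply: eq_bigr => s _ /=.
rewrite !exprD -!mulrA; congr (_ * _); rewrite !mulrA; congr (_ * _).
exact: (tXC (@rel n)).
Qed.

(** The convolution term of the trace equations arises here, from e_1. *)
Lemma tr2_ttgg a b : tr 2 (T 2 1 ^+ a * T 2 2 ^+ b * (G 2 1 * G 2 1)) =
  X a * X b
  + (u - 1) * (d%:R^-1 * \sum_(s < d) X (a + s) * X (b + (d - s)))
  + (u - 1) * z * X (a + b).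
Proof.
have -> : G 2 1 * G 2 1 =
    1 + (u - 1) *: e 2 1 + (u - 1) *: (e 2 1 * G 2 1).
  by apply: rel; apply: YH_quad.
rewrite !mulrDr mulr1 -(scalerAr (u - 1) _ (e 2 1)) -(scalerAr (u - 1)).
rewrite mulrA ttX_e //.
rewrite -scalerAl !linearD !linearZ /= tr2_tt big_distrl !linear_sum /=.
rewrite [V in _ + _ * (_ * V) + _](eq_bigr
  (fun s : 'I_d => X (a + s) * X (b + (d - s)))); last first.
  by move=> s _; rewrite tr2_tt.
rewrite [V in _ + _ * (_ * V)](eq_bigr (fun=> z * X (a + b))); last first.
  move=> s _; rewrite tr2_ttg addnACA subnKC; last exact: ltnW.
  by rewrite modnDr.
rewrite sumr_const card_ord -(mulr_natl (z * _)) mulKf //.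
by rewrite -[_ * z * _]mulrA.
Qed.

Definition tmono n a b c : Y n := T n 1 ^+ a * T n 2 ^+ b * T n 3 ^+ c.
Local Notation M := (tmono 3).

(** The next lemmas bring a product on three strands into the form inc a * t_3^c
    or inc a * g_2 * inc b, to which the Markov rules apply. *)
Lemma M_incl a b c :
  M a b c = inc (T 2 1 ^+ a * T 2 2 ^+ b) * T 3 3 ^+ c.
Proof. by rewrite /tmono rmorphM /= -!inc_tX. Qed.

Let g3 : G 3 1 = inc (G 2 1). Proof. by rewrite inc_g. Qed.

Lemma M_g1 a b c : M a b c * G 3 1 =
  inc (T 2 1 ^+ a * T 2 2 ^+ b * G 2 1) * T 3 3 ^+ c.
Proof.
rewrite M_incl -mulrA -(gX_tj (@rel 3) (i := 1) (j := 3)) //.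
by rewrite g3 mulrA -rmorphM.
Qed.

Lemma M_g2 a b c : M a b c * G 3 2 =
  inc (T 2 1 ^+ a * T 2 2 ^+ b) * G 3 2 * inc (T 2 2 ^+ c).
Proof.
rewrite M_incl -mulrA -(gX_t (@rel 3) (i := 2)) //.
by rewrite mulrA -inc_tX.
Qed.

Lemma M_g1g2 a b c : M a b c * G 3 1 * G 3 2 =
  inc (T 2 1 ^+ a * T 2 2 ^+ b * G 2 1) * G 3 2 * inc (T 2 2 ^+ c).
Proof.
rewrite M_g1 -mulrA -(gX_t (@rel 3) (i := 2)) //.
by rewrite mulrA -inc_tX.
Qed.

(** The six terms of g_{1,2} contribute, in this order, x_a x_b x_c,
    z x_{a+b} x_c, z x_a x_{b+c}, twice z^2 x_{a+b+c}, and, through the square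
    of g_1, z times the value of [tr2_ttgg]. *)
Lemma tr3_gij a b c :
  tr 3 (M a b c * gg 3 1 2) = trace_value u z d (fun k => X k) a b c.
Proof.
rewrite /gij !mulrDr mulr1 !linearD /= !mulrA.
rewrite M_g1g2 M_g1 M_g2 M_incl g3 -!mulrA -!rmorphM !mulrA !tr_tS // !tr_g2 //.
rewrite tr2_tt tr2_ttg.
have -> : tr 2 (T 2 2 ^+ c * (T 2 1 ^+ a * T 2 2 ^+ b)) = X a * X (b + c).
  by rewrite trC // -mulrA -exprD tr2_tt.
have -> : tr 2 (T 2 2 ^+ c * (T 2 1 ^+ a * T 2 2 ^+ b * G 2 1)) =
    z * X (a + b + c).
  rewrite -(mulrA (_ ^+ a)) mulrA (tXC (@rel 2)) // -mulrA (mulrA (_ ^+ c)).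
  by rewrite -exprD mulrA tr2_ttg -addnA (addnC b).
have -> : tr 2 (T 2 2 ^+ c * G 2 1 * (T 2 1 ^+ a * T 2 2 ^+ b)) =
    z * X (a + b + c).
  by rewrite trC // mulrA -(mulrA (_ ^+ a)) -exprD tr2_ttg addnA.
have -> : tr 2 (T 2 2 ^+ c * G 2 1 * (T 2 1 ^+ a * T 2 2 ^+ b * G 2 1)) =
    tr 2 (T 2 1 ^+ (a + c) * T 2 2 ^+ b * (G 2 1 * G 2 1)).
  rewrite trC // !mulrA -(mulrA (_ ^+ a * _) (G 2 1)) (gX_tS (@rel 2)) //.
  rewrite !mulrA -(mulrA (_ ^+ a) (_ ^+ b)) (tXC (@rel 2) b) // !mulrA.
  by rewrite -exprD.
rewrite tr2_ttgg /trace_value [(a + c + b)%N]addnAC.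
by move: (d%:R^-1 * _) => S; ring.
Qed.

Lemma tr_gij n a b c : (3 <= n)%N ->
  tr n (tmono n a b c * gg n 1 2) = trace_value u z d (fun k => X k) a b c.
Proof.
elim: n => // n IH; rewrite leq_eqVlt => /predU1P[[<-]|n3].
  exact: tr3_gij.
case: n n3 IH => [|[|[|n]]] // _ IH.
rewrite -IH // -[RHS]tr_inc //.
suff -> : inc (tmono n.+3 a b c * gg n.+3 1 2) =
    tmono n.+4 a b c * gg n.+4 1 2 by [].
rewrite /tmono /gij !(rmorphM, rmorphD, rmorph1, rmorphXn) /=.
by rewrite !inc_t ?inc_g.
Qed.

Lemma M_e1 a b c : M a b c * e 3 1 =
  d%:R^-1 *: \sum_(s < d) M (a + s) (b + (d - s)) c.
Proof.
have ce : T 3 3 ^+ c * e 3 1 = e 3 1 * T 3 3 ^+ c.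
  rewrite -scalerAr -scalerAl big_distrr big_distrl; congr (_ *: _).
  apply: eq_bigr => s _ /=.
  by rewrite mulrA (tXC (@rel 3) c s) // -[LHS]mulrA (tXC (@rel 3) c) // mulrA.
by rewrite /tmono -mulrA ce mulrA ttX_e // -scalerAl big_distrl.
Qed.

Lemma M_e2 a b c : M a b c * e 3 2 =
  d%:R^-1 *: \sum_(s < d) M a (b + s) (c + (d - s)).
Proof.
rewrite /tmono -!mulrA [T 3 2 ^+ b * _]mulrA ttX_e // -scalerAr big_distrr.
by congr (_ *: _); apply: eq_bigr => s _ /=; rewrite mulrA.
Qed.

Lemma g1_M a b c : G 3 1 * M a b c = M b a c * G 3 1.
Proof.
rewrite /tmono !mulrA (gX_t (@rel 3)) // -(mulrA (_ ^+ a)) (gX_tS (@rel 3)) //.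
rewrite mulrA -(mulrA _ (G 3 1)) (gX_tj (@rel 3)) // mulrA.
by rewrite (tXC (@rel 3) a b).
Qed.

Lemma g2_M a b c : G 3 2 * M a b c = M a c b * G 3 2.
Proof.
rewrite /tmono !mulrA (gX_tj (@rel 3)) // -(mulrA (_ ^+ a)) (gX_t (@rel 3)) //.
rewrite mulrA -(mulrA _ (G 3 2)) (gX_tS (@rel 3)) // mulrA.
by rewrite -(mulrA (_ ^+ a)) (tXC (@rel 3) b c) // mulrA.
Qed.

Hypothesis Yind : forall n (P : Y n -> Prop), P 1 ->
  (forall c x y, P x -> P y -> P (c *: x + y)) ->
  (forall i x, (0 < i < n)%N -> P x -> P (x * G n i)) ->
  (forall j x, (0 < j <= n)%N -> P x -> P (x * T n j)) ->
  forall x, P x.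

Hypothesis E : forall a b c, trace_value u z d (fun k => X k) a b c = 0.

(** The statement is strengthened by a framing monomial between y and g_{1,2}.
    A generator at the right end of y moves through the monomial: a framing
    changes one exponent, and g_i permutes the exponents and is then absorbed
    by g_{1,2}, which only creates further monomials. *)
Lemma tr3_mul_g12_eq0 (y : Y 3) : tr 3 (y * gg 3 1 2) = 0.
Proof.
suff H : forall a b c, tr 3 (y * M a b c * gg 3 1 2) = 0.
  by have := H 0 0 0; rewrite /tmono !expr0 !mulr1.
elim/Yind: y => [|k x' y' IHx IHy|i x' ri IH|j x' rj IH] a b c.
- by rewrite mul1r tr3_gij.
- by rewrite !mulrDl linearD -!scalerAl linearZ /= IHx IHy mulr0 addr0.
- have : (i == 1%N) || (i == 2%N) by case: i ri {IH} => [|[|[|]]].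
  case/predU1P=> [->|/eqP ->]; rewrite -(mulrA x').
    rewrite g1_M mulrA -mulrA (g_gij (@rel 3)) // mulrDr linearD IH add0r.
    rewrite -scalerAr linearZ mulrA -(mulrA x') M_e1.
    rewrite -scalerAr -scalerAl linearZ /= mulr_sumr mulr_suml linear_sum /=.
    by rewrite big1 ?mulr0 // => s _; rewrite IH.
  (* g_2 is absorbed by g_{1,2} because the latter equals g_{2,1}. *)
  rewrite g2_M mulrA -mulrA -(gij_sym (@rel 3)) // (g_gij (@rel 3)) //.
  rewrite (gij_sym (@rel 3)) // mulrDr linearD IH add0r.
  rewrite -scalerAr linearZ mulrA -(mulrA x') M_e2.
  rewrite -scalerAr -scalerAl linearZ /= mulr_sumr mulr_suml linear_sum /=.
  by rewrite big1 ?mulr0 // => s _; rewrite IH.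
- have : [|| j == 1%N, j == 2%N | j == 3%N] by case: j rj {IH} => [|[|[|[|]]]].
  rewrite -(mulrA x').
  case/or3P=> /eqP ->; last 2 first.
  + suff -> : T 3 2 * M a b c = M a b.+1 c by apply: IH.
    rewrite /tmono !mulrA -[V in V * _ * _ * _]expr1 (tXC (@rel 3)) //.
    by rewrite -(mulrA (_ ^+ a)) -exprD.
  + suff -> : T 3 3 * M a b c = M a b c.+1 by apply: IH.
    rewrite /tmono !mulrA -[V in V * _ * _ * _]expr1 (tXC (@rel 3)) //.
    by rewrite -(mulrA (_ ^+ a)) (tXC (@rel 3)) // mulrA -mulrA -exprD.
  suff -> : T 3 1 * M a b c = M a.+1 b c by apply: IH.
  by rewrite /tmono !mulrA -exprS.
Qed.

(** The elements on m + 1 strands to which a Markov rule can be applied.  On one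
    strand there is no g_m, hence the condition on m. *)
Inductive jones_span m : Y m.+1 -> Prop :=
| jones_t a s : jones_span (inc a * T m.+1 m.+1 ^+ s)
| jones_g a b of (0 < m)%N : jones_span (inc a * G m.+1 m * inc b)
| jones_lin c x y of jones_span x & jones_span y : jones_span (c *: x + y).

Lemma jones_span_inc m (a : Y m) : jones_span (inc a).
Proof. by rewrite -[inc a]mulr1 -(expr0 (T m.+1 m.+1)); apply: jones_t. Qed.

Lemma jones_span0 m : @jones_span m 0.
Proof. by rewrite -(rmorph0 (@inc m)); apply: jones_span_inc. Qed.

Lemma jones_spanD m (a b : Y m.+1) :
  jones_span a -> jones_span b -> jones_span (a + b).
Proof. by move=> ja jb; rewrite -[a]scale1r; apply: jones_lin. Qed.

Lemma jones_spanZ m c (a : Y m.+1) : jones_span a -> jones_span (c *: a).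
Proof. by move=> ja; rewrite -[_ *: _]addr0; apply/jones_lin/jones_span0. Qed.

Lemma T_comm m (b : Y m) s :
  T m.+1 m.+1 ^+ s * inc b = inc b * T m.+1 m.+1 ^+ s.
Proof.
elim/Yind: b => [|c a b IHa IHb|i a ri IH|j a rj IH].
- by rewrite rmorph1 mulr1 mul1r.
- by rewrite linearP mulrDl mulrDr -scalerAl -scalerAr IHa IHb.
- have [i0 im] := andP ri.
  rewrite rmorphM mulrA IH -!mulrA /= inc_g //; congr (_ * _).
  apply/esym/(gX_tj (@rel m.+1)); rewrite ?i0 ?leqnn ?ltnS ?eqSS //.
  - exact: ltnW.
  - by rewrite gtn_eqF // ltnS ltnW.
  - by rewrite gtn_eqF.
- rewrite rmorphM mulrA IH -!mulrA /= inc_t //; congr (_ * _).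
  have [j0 jm] := andP rj; rewrite -[T _ j]expr1 (tXC (@rel m.+1)) ?leqnn //.
  by rewrite j0 leqW.
Qed.

Lemma G_comm m (b : Y m) :
  G m.+2 m.+1 * inc (inc b) = inc (inc b) * G m.+2 m.+1.
Proof.
elim/Yind: b => [|c a b IHa IHb|i a ri IH|j a rj IH].
- by rewrite !rmorph1 mulr1 mul1r.
- by rewrite !linearP mulrDl mulrDr -scalerAl -scalerAr IHa IHb.
- have [i0 im] := andP ri; have ri' : (0 < i < m.+1)%N by rewrite i0 leqW.
  rewrite !rmorphM mulrA IH -!mulrA /= !inc_g //; congr (_ * _).
  apply: rel; apply: YH_ggC; rewrite ?ltnS ?leqnn ?i0 ?im ?orbT //=.
  by rewrite 2?ltnW // !ltnS ltnW.
- have [j0 jm] := andP rj; have rj' : (0 < j <= m.+1)%N by rewrite j0 leqW.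
  rewrite !rmorphM mulrA IH -!mulrA /= !inc_t //; congr (_ * _).
  apply: rel; apply: YH_gt_j; rewrite ?ltnS ?leqnn ?j0 ?leqW //.
    by rewrite ltn_eqF.
  by rewrite ltn_eqF // ltnS leqW.
Qed.

Lemma jones_span_mulr m (b : Y m) y : jones_span y -> jones_span (y * inc b).
Proof.
elim=> {y} [a s|a b' m0|c x' y' _ IHx _ IHy].
- by rewrite -mulrA T_comm mulrA -rmorphM; apply: jones_t.
- by rewrite -mulrA -rmorphM; apply: jones_g.
- by rewrite mulrDl -scalerAl; apply: jones_lin.
Qed.

Lemma jones_span_mulT m (y : Y m.+1) :
  jones_span y -> jones_span (y * T m.+1 m.+1).
Proof.
elim=> {y} [a s|a b' m0|c x' y' _ IHx _ IHy].
- by rewrite -mulrA -exprSr; apply: jones_t.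
- rewrite -mulrA -[T _ _]expr1 -T_comm mulrA -(mulrA _ (G _ _)).
  rewrite (gX_tS (@rel m.+1)) ?m0 ?leqnn // mulrA inc_tX ?m0 ?leqnn //.
  by rewrite -rmorphM; apply: jones_g.
- by rewrite mulrDl -scalerAl; apply: jones_lin.
Qed.

Lemma jones_span_tg m (a : Y m) s : (0 < m)%N ->
  jones_span (inc a * T m.+1 m.+1 ^+ s * G m.+1 m).
Proof.
move=> m0; rewrite -mulrA -(gX_t (@rel m.+1)) ?m0 ?leqnn //.
by rewrite inc_tX ?m0 ?leqnn // mulrA; apply: jones_g.
Qed.

Lemma jones_span_tgg m (a : Y m) s : (0 < m)%N ->
  jones_span (inc a * T m.+1 m.+1 ^+ s * (G m.+1 m * G m.+1 m)).
Proof.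
move=> m0; have rm : (0 < m < m.+1)%N by rewrite m0 ltnSn.
have -> : G m.+1 m * G m.+1 m =
    1 + (u - 1) *: e m.+1 m + (u - 1) *: (e m.+1 m * G m.+1 m).
  by apply: rel; apply: YH_quad.
have je (f : nat -> nat) y :
    (forall k,
      jones_span (inc a * (T m.+1 m ^+ k * T m.+1 m.+1 ^+ f k) * y)) ->
    jones_span
      (inc a * (\sum_(k < d) T m.+1 m ^+ k * T m.+1 m.+1 ^+ f k) * y).
  move=> H; rewrite mulr_sumr mulr_suml; elim/big_ind: _ => //.
    exact: jones_span0.
  exact: jones_spanD.
have te : T m.+1 m.+1 ^+ s * e m.+1 m = d%:R^-1 *:
    \sum_(k < d) (T m.+1 m ^+ k * T m.+1 m.+1 ^+ (s + (d - k))).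
  by have := ttX_e 0 s rm; rewrite expr0 mul1r => ->.
have tk (k : nat) p : inc a * (T m.+1 m ^+ k * T m.+1 m.+1 ^+ p) =
    inc (a * T m m ^+ k) * T m.+1 m.+1 ^+ p.
  by rewrite inc_tX ?m0 ?leqnn // mulrA -rmorphM.
move: (e m.+1 m) te => E' te.
rewrite !mulrDr mulr1 -!scalerAr mulrA -(mulrA (inc a)) te.
rewrite -scalerAr -scalerAl; apply: jones_spanD; first apply: jones_spanD.
- exact: jones_t.
- apply/jones_spanZ/jones_spanZ; rewrite -[_ * \sum_(_ < _) _]mulr1.
  apply: (je (fun k => s + (d - k))%N) => k.
  by rewrite mulr1 tk; apply: jones_t.
- apply/jones_spanZ/jones_spanZ/(je (fun k => s + (d - k))%N) => k.
  by rewrite tk; apply: jones_span_tg.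
Qed.

(** This is where the induction over the number of strands enters.  In the
    decomposition of b, the factors from m strands commute with g = g_(m+1),
    which leaves g t_(m+1)^s g = t_(m+2)^s g^2 and the braid relation
    g g_m g = g_m g g_m. *)
Lemma jones_span_gbg m (a b : Y m.+1) : jones_span b ->
  jones_span (inc a * G m.+2 m.+1 * inc b * G m.+2 m.+1).
Proof.
move=> jb; elim: jb a => {b} [b s|b b' m0|c x' y' _ IHx _ IHy] a.
- rewrite rmorphM /= -inc_tX ?leqnn // mulrA -(mulrA (inc a)) G_comm mulrA.
  rewrite -(mulrA _ (G _ _)) (gX_t (@rel m.+2)) ?ltnSn // mulrA -rmorphM -mulrA.
  exact: jones_span_tgg.
- have br (v : Y m.+2) : v * G m.+2 m.+1 * G m.+2 m * G m.+2 m.+1 =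
      v * G m.+2 m * G m.+2 m.+1 * G m.+2 m.
    rewrite -!mulrA; congr (_ * _); rewrite !mulrA.
    exact/rel/YH_braid.
  rewrite !rmorphM /= inc_g ?m0 ?ltnSn // !mulrA -(mulrA (inc a)) G_comm mulrA.
  rewrite -(mulrA _ _ (G _ _)) -G_comm mulrA br -inc_g ?m0 ?ltnSn //.
  by rewrite -!rmorphM -mulrA -rmorphM; apply: jones_g.
- rewrite linearP mulrDr mulrDl -scalerAr -scalerAl.
  by apply: jones_lin.
Qed.

(** The span contains 1 and is stable under right multiplication by the
    generators; only the last g_m is not immediate. *)
Lemma jones_spanT m (y : Y m.+1) : jones_span y.
Proof.
elim: m y => [|m IHm]; elim/Yind => [|c a b IHa IHb|i a ri IH|j a rj IH].
- by rewrite -(rmorph1 (@inc 0)); apply: jones_span_inc.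
- exact: jones_lin.
- by case: i ri.
- have -> : j = 1%N by case: j rj => [|[]].
  exact: jones_span_mulT.
- by rewrite -(rmorph1 (@inc m.+1)); apply: jones_span_inc.
- exact: jones_lin.
- have [i0] := andP ri; rewrite ltnS leq_eqVlt => /predU1P[->|im]; last first.
    by rewrite -inc_g ?i0 //; apply: jones_span_mulr.
  elim: IH => {a} [a s|a b _|c x' y' _ IHx _ IHy].
  + exact: jones_span_tg.
  + exact/jones_span_gbg/IHm.
  + by rewrite mulrDl -scalerAl; apply: jones_lin.
- have [j0] := andP rj; rewrite leq_eqVlt => /predU1P[->|jm]; last first.
    by rewrite -inc_t ?j0 //; apply: jones_span_mulr.
  exact: jones_span_mulT.
Qed.

Lemma inc_gij n : (2 < n)%N -> inc (gg n 1 2) = gg n.+1 1 2.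
Proof.
case: n => [|[|[|n]]] // _.
by rewrite /gij !(rmorphM, rmorphD, rmorph1) /= !inc_g.
Qed.

(** Induction on the number of strands: since g_{1,2} lives on three strands, a
    Markov rule strips the last strand from y and leaves a trace of the same
    shape on one strand less. *)
Lemma tr_mul_g12_eq0 n (y : Y n) : (2 < n)%N -> tr n (y * gg n 1 2) = 0.
Proof.
elim: n y => // n IH y; rewrite leq_eqVlt => /predU1P[[n2]|n3].
  by move: y; rewrite -n2; apply: tr3_mul_g12_eq0.
have n0 : (0 < n)%N by case: n n3 {IH y}.
rewrite -inc_gij //.
elim: (jones_spanT y) => {y} [a s|a b _|c x' y' _ IHx _ IHy].
- by rewrite -mulrA T_comm mulrA -rmorphM tr_tS // IH ?mulr0.
- by rewrite -mulrA -rmorphM tr_g2 // trC // mulrA IH ?mulr0.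
- by rewrite mulrDl linearD -scalerAl linearZ /= IHx IHy mulr0 addr0.
Qed.

Lemma tr_mul_gadj_eq0 n i (y : Y n) : (0 < i)%N -> (i.+1 < n)%N ->
  tr n (y * gg n i i.+1) = 0.
Proof.
elim: i y => // -[|i] IH y _ iSn; first exact: tr_mul_g12_eq0.
have i2 : (i.+2 < n)%N by apply: ltnW.
have i1 : (i.+1 < n)%N by apply: ltnW.
have n0 : (0 < n)%N by apply: leq_trans iSn.
have [a1 _] := ginvE (@rel n) dK u0 (i1 : (0 < i.+1 < n)%N).
have [a2 _] := ginvE (@rel n) dK u0 (i2 : (0 < i.+2 < n)%N).
have [a3 _] := ginvE (@rel n) dK u0 (iSn : (0 < i.+3 < n)%N).
set v1 := ginv _ _ _ _ i.+1 in a1; set v2 := ginv _ _ _ _ i.+2 in a2.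
set v3 := ginv _ _ _ _ i.+3 in a3.
have := gij_conj (@rel n) (ltn0Sn i) iSn.
set h := G n i.+1 * G n i.+2 * G n i.+3 => hg.
have hv : h * (v3 * v2 * v1) = 1.
  by rewrite /h !mulrA -(mulrA _ _ v3) a3 mulr1 -(mulrA _ _ v2) a2 mulr1 a1.
by rewrite -[y * _]mulr1 -hv mulrA -(mulrA y) -hg trC // !mulrA IH.
Qed.

Lemma tr_mul_gij_eq0 n i j (y : Y n) : (0 < i < n)%N -> (0 < j < n)%N ->
  (i == j.+1) || (j == i.+1) -> tr n (y * gg n i j) = 0.
Proof.
move=> /andP[i0 iln] /andP[j0 jln] /orP[] /eqP E'; subst.
  by rewrite (gij_sym (@rel n)) // tr_mul_gadj_eq0.
by rewrite tr_mul_gadj_eq0.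
Qed.

End Tower.

(** The criterion does not depend on n: three strands carry all the
    equations. *)
Lemma passes_to_YTLP (K : fieldType) (u : K) (d : nat) (d_gt0 : (0 < d)%N)
    (dK : d%:R != 0 :> K) (u0 : u != 0) (z : K) (x : nat -> K)
    (tr : forall m : nat, {scalar YH u d m}) (n : nat) :
    x 0 = 1 -> (2 < n)%N -> is_markov_trace z x tr ->
  passes_to_YTL (tr n) <->
  forall a b c, trace_value u z d (fun k => x (k %% d)%N) a b c = 0.
Proof.
move=> x0 n3 htr.
pose inc m : {lrmorphism YH u d m -> YH u d m.+1} := @YH_incl K u d m.
have rel m := @YH_relP K u d m.
have inc_g : forall m i, (0 < i < m)%N -> inc m (YHg u d m i) = YHg u d m.+1 i.
  by move=> m i ri; apply: YH_incl_g.
have inc_t : forall m i, (0 < i <= m)%N -> inc m (YHt u d m i) = YHt u d m.+1 i.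
  by move=> m i ri; apply: YH_incl_t.
have [tr_inc trC tr1 trg trt] := htr.
split=> [pass a b c|E y].
  rewrite -(tr_gij d_gt0 dK u0 (inc := inc) rel inc_g inc_t
    tr_inc trC tr1 trg trt x0 a b c n3).
  apply: pass; apply: ideal_genMl; apply: ideal_gen_mem.
  by exists 1%N, 2%N; split=> //; apply: leq_trans n3.
apply: ideal_gen_trace => [p q|p s [i [j [ri rj ij ->]]]].
  by apply: trC; apply: leq_trans n3.
exact: (tr_mul_gij_eq0 d_gt0 dK u0 (inc := inc) rel inc_g inc_t
  tr_inc trC tr1 trg trt x0 (@YH_ind K u d) E p ri rj ij).
Qed.

(** * Specialization to C(u) *)

(** The case m = p = 0 identifies d c with the sum on the right-hand side of the
    E-system. *)
Lemma E_system_of_convolution (C : fieldType) (d : nat) (x : nat -> C) (c : C) :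
    (0 < d)%N -> x 0 = 1 ->
    (forall m p, \sum_(s < d) x ((m + s) %% d)%N * x ((p + (d - s)) %% d)%N =
      d%:R * (c * x ((m + p) %% d)%N)) ->
  E_system d x.
Proof.
move=> d0 x0 conv m /andP[m1 md].
have {}md : (m < d)%N by case: d d0 md {conv}.
have := conv m 0%N; rewrite addn0 modn_small // => ->.
have := conv 0%N 0%N; rewrite mod0n x0 mulr1 => Hc.
rewrite mulrA -{}Hc mulrC; congr (_ * _).
by apply: eq_bigr => s _; rewrite add0n modn_small.
Qed.

Section RootsOfUnity.
Variable R : realType.

Lemma expdE d (k : nat) : expd R d k = expd R d 1%N ^+ k.
Proof.
elim: k => [|k IH].
  by rewrite /expd mulr0z !mulr0 mul0r cos0 sin0.
rewrite exprSr -IH /expd.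
have -> : 2 * pi * k.+1%:Z%:~R / d%:R =
    2 * pi * k%:Z%:~R / d%:R + 2 * pi * 1%:Z%:~R / d%:R :> R.
  by rewrite -mulrDl -mulrDr -!pmulrn natr1.
rewrite cosD sinD; apply/eqP; rewrite eq_complex /=.
by rewrite eqxx addrC eqxx.
Qed.

(** If the m-th power were 1 for some 0 < m < d, its real part
    1 - 2 sin^2 (pi m / d) would be 1, but the sine is positive on (0, pi). *)
Lemma expd_primitive d : (0 < d)%N -> d.-primitive_root (expd R d 1%N).
Proof.
move=> d0; have dR : d%:R != 0 :> R by rewrite pnatr_eq0 -lt0n.
have wd : expd R d 1%N ^+ d = 1.
  rewrite -expdE /expd mulfK //.
  by rewrite mulr_natl cos2pi sin2pi.
have [m wm md] := prim_order_exists d0 wd.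
have m0 := prim_order_gt0 wm.
suff dm : d = m by rewrite {1}dm.
apply/eqP; rewrite eqn_leq (dvdn_leq d0 md) andbT leqNgt; apply/negP => mltd.
have := prim_expr_order wm; rewrite -expdE /expd => /eqP.
rewrite eq_complex /= => /andP[/eqP + _].
have -> : 2 * pi * m%:Z%:~R / d%:R = (pi * (m%:R / d%:R)) *+ 2 :> R.
  by rewrite -pmulrn -[RHS]mulr_natl !mulrA.
rewrite cos_mulr2n cos2sin2.
have : 0 < sin (pi * (m%:R / d%:R) : R).
  apply: sin_gt0_pi; rewrite mulr_gt0 ?pi_gt0 ?divr_gt0 ?ltr0n //=.
  by rewrite gtr_pMr ?pi_gt0 // ltr_pdivrMr ?ltr0n // mul1r ltr_nat.
move: (sin _) => s s0 E.
have : s ^+ 2 = 0 by nra.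
by move/eqP; rewrite sqrf_eq0 gt_eqF.
Qed.

HB.instance Definition _ := GRing.RMorphism.copy (@Cfrac_const R)
  (@tofrac {poly R[i]} \o @polyC R[i]).

Lemma Cfrac_u_neq0 : Cfrac_u R != 0.
Proof. by rewrite tofrac_eq0 polyX_eq0. Qed.

Lemma Cfrac_u1_neq0 : Cfrac_u R + 1 != 0.
Proof.
by rewrite -tofrac1 -tofracD tofrac_eq0 -[1]opprK -polyCN polyXsubC_eq0.
Qed.

Lemma Cfrac_nat_neq0 n : (0 < n)%N -> n%:R != 0 :> Cfrac R.
Proof.
by move=> n0; rewrite -(rmorph_nat (@Cfrac_const R)) fmorph_eq0 pnatr_eq0 -lt0n.
Qed.

End RootsOfUnity.

Theorem theorem5 (R : realType) (d n : nat) (hd : (1 <= d)%N) (hn : (3 <= n)%N)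
    (x : nat -> R[i]) (x0 : x 0%N = 1) (z : Cfrac R)
    (tr : forall m : nat, {scalar YH (Cfrac_u R) d m})
    (htr : is_markov_trace z (fun s => Cfrac_const (x s)) tr) :
  passes_to_YTL (tr n) <->
  E_system d x /\
  ((exists m1 : nat,
      [/\ (m1 <= d.-1)%N,
          forall l : nat, (l <= d.-1)%N -> x l = expd R d (l * m1)%N &
          z = - (Cfrac_u R + 1)^-1 \/ z = - 1])
   \/
   (exists m1 m2 : nat,
      [/\ (m1 <= d.-1)%N, (m2 <= d.-1)%N, m1 <> m2,
          forall l : nat, (l <= d.-1)%N ->
            x l = 2^-1 * (expd R d (l * m1)%N + expd R d (l * m2)%N) &
          z = - 2^-1])).
Proof.
have w_prim := expd_primitive R hd; set w := expd R d 1%N in w_prim.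
pose iota : {rmorphism R[i] -> Cfrac R} := @Cfrac_const R.
have W_prim : d.-primitive_root (iota w) by rewrite fmorph_primitive_root.
have dK : d%:R != 0 :> Cfrac R by apply: Cfrac_nat_neq0.
have twoK : (2 : Cfrac R) != 0 by apply: Cfrac_nat_neq0.
have two : (2 : R[i]) != 0 by rewrite pnatr_eq0.
have half_sum a b : iota (2^-1 * (a + b)) = 2^-1 * (iota a + iota b).
  by rewrite rmorphM fmorphV rmorph_nat rmorphD.
have X0 : iota (x 0%N) = 1 by rewrite x0 rmorph1.
have lt_d l : (l <= d.-1)%N = (l < d)%N by rewrite -ltnS prednK.
have expdM l m : expd R d (l * m)%N = w ^+ m ^+ l by rewrite expdE mulnC exprM.
have wmod m l : w ^+ m ^+ (l %% d) = w ^+ m ^+ l.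
  exact: expr_mod (prim_root_expX w_prim m).
rewrite (passes_to_YTLP hd dK (Cfrac_u_neq0 R) X0 hn htr).
rewrite (trace_value_eq0P W_prim dK twoK); last 2 first.
- by rewrite mod0n.
- by move=> k; rewrite modn_mod.
split=> [[[m [XE zE]]|[m1 [m2 [m12 XE zE]]]]|
  [_ [[m [md xE zE]]|[m1 [m2 [m1d m2d m12 xE zE]]]]]].
- have xE k : x (k %% d)%N = w ^+ m ^+ k.
    by apply: (fmorph_inj iota); rewrite [LHS]XE !rmorphXn.
  split.
    apply: (E_system_of_convolution (c := 1)) => // p q.
    by rewrite (convolution_char w_prim xE) mul1r.
  left; exists m; split.
  + by rewrite lt_d.
  + by move=> l; rewrite lt_d => ld; rewrite expdM -xE modn_small.
  + exact/(linear_factors_eq0 _ (Cfrac_u1_neq0 R)).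
- have xE k : x (k %% d)%N = 2^-1 * (w ^+ m1 ^+ k + w ^+ m2 ^+ k).
    apply: (fmorph_inj iota); rewrite [LHS]XE half_sum.
    by rewrite !rmorphXn.
  split.
    apply: (E_system_of_convolution (c := 2^-1)) => // p q.
    exact: (convolution_char2 w_prim two m12 xE).
  right; exists m1, m2; split.
  + by rewrite lt_d.
  + by rewrite lt_d.
  + by apply/eqP.
  + by move=> l; rewrite lt_d => ld; rewrite !expdM -xE modn_small.
  + by [].
- rewrite lt_d in md; left; exists (Ordinal md); split.
    move=> k; rewrite xE ?lt_d ?ltn_mod // expdM wmod.
    by rewrite /= !rmorphXn.
  exact/(linear_factors_eq0 _ (Cfrac_u1_neq0 R)).
- rewrite lt_d in m1d; rewrite lt_d in m2d.
  right; exists (Ordinal m1d), (Ordinal m2d); split=> //.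
    by apply/eqP=> -[].
  move=> k; rewrite xE ?lt_d ?ltn_mod // !expdM !wmod.
  by rewrite [LHS]half_sum !rmorphXn.
Qed.
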